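(* Let $0<H<1$ and let $\{Y_t,\ t\in\mathbb{R}\}$ be a stationary CARFIMA$(p,H,q)$ process with parameters $\alpha_0,\dots,\alpha_p,\beta_1,\dots,\beta_q,H,\sigma$ (as defined in the context; in particular all eigenvalues of the companion matrix $A$ have negative real parts). Then the spectral density function of $\{Y_t,\ t\in\mathbb{R}\}$ is given by $$f_Y(w)=\frac{\sigma^2}{2\pi}\,\Gamma(2H+1)\sin(\pi H)\,|w|^{1-2H}\,\frac{|\beta(iw)|^2}{|\alpha(iw)|^2},\qquad w\in(-\infty,\infty),$$ where $\alpha(z)=z^p-\alpha_pz^{p-1}-\cdots-\alpha_1$, $\beta(z)=1+\beta_1z+\cdots+\beta_qz^q$ and $i=\sqrt{-1}$.
   Context: Prime denotes transpose. $\{B_t^H\}_{t\in\mathbb{R}}$ is a standard (two-sided) fractional Brownian motion with Hurst parameter $H\in(0,1)$: a zero-mean Gaussian process with $B_0^H=0$ and $E(B_t^HB_s^H)=\frac12\{|t|^{2H}+|s|^{2H}-|t-s|^{2H}\}$. Parameters: integers $p\ge1$, $0\le q<p$; real $\alpha_0,\dots,\alpha_p,\beta_1,\dots,\beta_q$ with $\alpha_1\ne0$ and (if $q\ge1$) $\beta_q\ne0$; $\sigma>0$. $A$ is the $p\times p$ companion matrix whose $(i,i+1)$ entries are $1$ for $1\le i\le p-1$, whose last row is $(\alpha_1,\dots,\alpha_p)$, and all of whose other entries are $0$ (for $p=1$, $A=(\alpha_1)$). $\delta_p=(0,\dots,0,1)'\in\mathbb{R}^p$. The vector $\beta=(1,\beta_1,\dots,\beta_{p-1})'\in\mathbb{R}^p$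 has $\beta_j=0$ for $j>q$. A CARFIMA$(p,H,q)$ process is $Y_t=\beta'X_t$, where $dX_t=(AX_t+\alpha_0\delta_p)\,dt+\sigma\delta_p\,dB_t^H$. When all eigenvalues of $A$ have negative real parts, the stationary CARFIMA process is $$Y_t=-\frac{\alpha_0}{\alpha_1}+\sigma\int_{-\infty}^t\beta'e^{A(t-u)}\delta_p\,dB_u^H,\qquad t\in\mathbb{R},$$ the stochastic integral of the deterministic integrand being the mean-square limit of Riemann sums. The spectral density of a stationary process with autocovariance function $\gamma_Y(h)=\operatorname{cov}(Y_{t+h},Y_t)$ is the nonnegative integrable function $f_Y$ on $\mathbb{R}$ (unique up to null sets) with $\gamma_Y(h)=\int_{-\infty}^\infty e^{ihw}f_Y(w)\,dw$ for all $h\in\mathbb{R}$. *)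

(* Defs.v *)
From HB Require Import structures.
From mathcomp Require Import all_boot all_order all_algebra.
From mathcomp Require Import complex.
From mathcomp Require Import all_classical all_reals all_analysis.

Set Implicit Arguments.
Unset Strict Implicit.
Unset Printing Implicit Defensive.

Import Order.TTheory GRing.Theory Num.Theory.
Import numFieldNormedType.Exports.

Local Open Scope classical_set_scope.
Local Open Scope ring_scope.

Section special_functions.
Variable R : realType.

(* Euler's Gamma function, intended for x > 0. *)
Definition Gamma (x : R) : R :=
  \int[lebesgue_measure]_(t in `]0, +oo[) (t `^ (x - 1) * expR (- t)).

Definition expmx (p : nat) (A : 'M[R]_p) : 'M[R]_p :=
  limn (series (fun k : nat => k`!%:R^-1 *: A ^+ k)).

Definition expi (theta : R) : R[i] := (cos theta +i* sin theta)%C.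

Definition Cintegral (F : R -> R[i]) : R[i] :=
  ((\int[lebesgue_measure]_x complex.Re (F x)) +i*
   (\int[lebesgue_measure]_x complex.Im (F x)))%C.

(* The norm of R[i] is itself R[i]-valued; cabs is the modulus as a real. *)
Definition cabs (z : R[i]) : R := complex.Re `|z|.

End special_functions.

Section processes.
Context d (T : measurableType d) (R : realType) (P : probability T R).
Local Open Scope ereal_scope.

(* Point masses count as Gaussian.  The two laws are compared on measurable
   sets only, since [distribution] and [normal_prob] are functions defined on
   all sets. *)
Definition gaussian_rv (X : {RV P >-> R}) : Prop :=
  (exists m : R, {ae P, forall w, X w = m}) \/
  (exists m s : R, (0 < s)%R /\
     forall U, measurable U -> distribution P X U = normal_prob m s U).

Definition gaussian_process (X : R -> {RV P >-> R}) : Prop :=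
  forall (n : nat) (c t : 'I_n -> R),
    gaussian_rv (\sum_(i < n) c i *: (X (t i) : {mfun T >-> R}))%R.

Definition is_fBm (H : R) (B : R -> {RV P >-> R}) : Prop :=
  [/\ gaussian_process B,
      {ae P, forall w, B 0%R w = 0%R},
      forall t, 'E_P[B t] = 0 &
      forall t s, 'E_P[(B t : T -> R) \* (B s : T -> R)] =
        (2^-1 * (`|t| `^ (2 * H) + `|s| `^ (2 * H)
                 - `|t - s| `^ (2 * H)))%:E].

Definition ms_dist (X Z : T -> R) : \bar R :=
  'E_P[fun w => ((X w - Z w) ^+ 2)%R].

(* a = u_0 <= xi_0 <= u_1 <= ... <= xi_{n-1} <= u_n = b, of mesh < delta *)
Definition tagged_partition (a b delta : R) (n : nat) (u xi : nat -> R) :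
    Prop :=
  [/\ u 0%N = a, u n = b &
      forall i, (i < n)%N -> (u i <= xi i <= u i.+1)%R /\
                             (u i.+1 - u i < delta)%R].

Definition riemann_sum (g : R -> R) (B : R -> T -> R) (n : nat)
    (u xi : nat -> R) : T -> R :=
  fun w => (\sum_(i < n) g (xi i) * (B (u i.+1) w - B (u i) w))%R.

(* I is the integral of g dB over [a, b] *)
Definition is_ms_integral (B : R -> T -> R) (g : R -> R) (a b : R)
    (I : T -> R) : Prop :=
  forall e : R, (0 < e)%R -> exists2 delta : R, (0 < delta)%R &
    forall (n : nat) (u xi : nat -> R), tagged_partition a b delta n u xi ->
      ms_dist (riemann_sum g B n u xi) I < e%:E.

(* I is the integral of g dB over (-oo, t], the mean-square limit of the
   integrals over [a, t] as a tends to -oo *)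
Definition is_ms_integral_ninfty (B : R -> {RV P >-> R}) (g : R -> R) (t : R)
    (I : {RV P >-> R}) : Prop :=
  exists J : R -> {RV P >-> R},
    (forall a, (a <= t)%R -> is_ms_integral B g a t (J a)) /\
    ms_dist (J a) I @[a --> -oo%R] --> 0.

Definition weakly_stationary (Y : R -> {RV P >-> R}) : Prop :=
  [/\ forall t, (Y t : T -> R) \in Lfun P 2%:E,
      exists m : R, forall t, 'E_P[Y t] = m%:E &
      forall t h, covariance P (Y (t + h)%R) (Y t) =
                  covariance P (Y h) (Y 0%R)].

Definition autocovariance (Y : R -> {RV P >-> R}) (h : R) : R :=
  fine (covariance P (Y h) (Y 0%R)).

Definition is_spectral_density (Y : R -> {RV P >-> R}) (f : R -> R) : Prop :=
  [/\ weakly_stationary Y,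
      forall w, (0 <= f w)%R,
      lebesgue_measure.-integrable setT (EFin \o f) &
      forall h, (autocovariance Y h)%:C%C =
        Cintegral (fun w => expi (h * w) * (f w)%:C%C)%R].

End processes.

Section carfima.
Context (R : realType) (p q : nat) (alpha beta : nat -> R).

(* Rows and columns are numbered from 0; only alpha 0, ..., alpha p and
   beta 1, ..., beta q are ever used. *)
Definition companion : 'M[R]_p :=
  \matrix_(i < p, j < p)
    if i.+1 == p then alpha j.+1 else (j == i.+1 :> nat)%:R.

Definition delta_vec : 'cV[R]_p := \col_(i < p) (i.+1 == p)%:R.

Definition beta_vec : 'cV[R]_p :=
  \col_(i < p) if i == 0%N :> nat then 1
               else if (i <= q)%N then beta i else 0.

Definition carfima_kernel (s : R) : R :=
  (beta_vec^T *m expmx (s *: companion) *m delta_vec) 0 0.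

Definition stable : Prop :=
  forall z : R[i], eigenvalue (map_mx (real_complex R) companion) z ->
    complex.Re z < 0.

Definition is_stationary_carfima d (T : measurableType d)
    (P : probability T R) (sigma : R) (B Y : R -> {RV P >-> R}) : Prop :=
  stable /\
  forall t, exists2 I : {RV P >-> R},
    is_ms_integral_ninfty B (fun u => carfima_kernel (t - u)) t I &
    {ae P, forall w, Y t w = - (alpha 0%N / alpha 1%N) + sigma * I w}.

Definition alpha_poly : {poly R} :=
  'X^p - \sum_(k < p) alpha k.+1 *: 'X^k.

Definition beta_poly : {poly R} :=
  1 + \sum_(1 <= j < q.+1) beta j *: 'X^j.

Definition ceval (a : {poly R}) (z : R[i]) : R[i] :=
  (map_poly (real_complex R) a).[z].

(* At w = 0 with H > 1/2, where |w|^{1-2H} has its pole, [powR] gives 0. *)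
Definition carfima_spectral_density (H sigma w : R) : R :=
  sigma ^+ 2 / (2 * pi) * Gamma (2 * H + 1) * sin (pi * H)
  * `|w| `^ (1 - 2 * H)
  * (cabs (ceval beta_poly (0 +i* w)%C) ^+ 2
     / cabs (ceval alpha_poly (0 +i* w)%C) ^+ 2).

End carfima.

(* Main.v *)
(* Fractional Brownian motion has the harmonizable covariance
   2 k cov(B_t, B_s) = int_0^oo Re ((e^{itw} - 1) conj (e^{isw} - 1)) w^(-1-2H) dw
   with k = int_0^oo (1 - cos w) w^(-1-2H) dw.  So sum_j c_j B_{t_j} |->
   sum_j c_j (e^{i t_j w} - 1) is, up to a constant, an isometry from step
   integrals into L^2(w^(-1-2H) dw), and it extends to mean-square limits.
   Along uniform partitions the images of the Riemann sums of
   int_{-oo}^t beta' e^{A(t-u)} delta dB_u are geometric sums of matrices, which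
   converge pointwise to e^{itw} (iw) beta' (iw - A)^{-1} delta
   = e^{itw} (iw) beta(iw) / alpha(iw).  Polarizing the isometry gives the
   autocovariance as a cosine transform over the half-line, and
   k Gamma(2H+1) sin(pi H) = pi / 2 turns its constant into the stated one. *)

Require Import Defs.
From HB Require Import structures.
From mathcomp Require Import all_boot all_order all_algebra.
From mathcomp Require Import complex ring lra.
From mathcomp Require Import all_classical all_reals all_analysis measurable_realfun.

Set Implicit Arguments.
Unset Strict Implicit.
Unset Printing Implicit Defensive.

Import Order.TTheory GRing.Theory Num.Theory.
Import numFieldNormedType.Exports.

Local Open Scope classical_set_scope.
Local Open Scope ring_scope.

(** * Power integrals *)

Section scaling.
Variable R : realType.
Local Notation mu := (@lebesgue_measure R).
Local Open Scope ereal_scope.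

(** The stochastic integral enters only through its defining mean-square limit. Any tagged partition
    may be used there; uniform ones with left tags are chosen because the sums then involve powers
    of the single matrix e^{(A - iw)h}. The geometric sum is evaluated after multiplication by (1 -
    e^{(A - iw)h}) / h, which tends to iw - A as the mesh vanishes, while stability removes the far
    end. Pointwise limits say nothing yet about L^2 norms: mean-square Cauchy sums have Cauchy
    images, and Fatou's lemma identifies the L^2 limit of the images with their pointwise limit. The
    phase e^{itw} is the only trace of t, hence stationarity. The constant originates in the Laplace
    transform of 1 - cos(tw): integrating k t^(2H) e^{-t} over t and exchanging integrals gives k
    Gamma(2H+1) = int_0^oo w^(1-2H) / (1 + w^2) dw, which is pi / (2 sin(pi H)). That integral is
    computed by real means, with geometric expansions on both sides of 1 and a Fejer-type comparison
    with the arctangent case. *)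

Lemma lebesgue_measure_scale (c : R) (A : set R) : (0 < c)%R -> measurable A ->
  c%:E * pushforward mu ( *%R c : _ -> measurableTypeR R) A = mu A.
Proof.
move=> c0 mA; have cge0 : (0 <= c)%R by exact: ltW.
have mc : measurable_fun [set: measurableTypeR R]
  ( *%R c : measurableTypeR R -> measurableTypeR R) by exact: mulrl_measurable.
(* An abstract measure with the values of the pushforward, to which [mscale] and the uniqueness of
   Lebesgue measure, tested on half-open intervals, apply. *)
have [nu nuE] : exists nu : {measure set (measurableTypeR R) -> \bar R},
    forall X, nu X = pushforward mu ( *%R c : _ -> measurableTypeR R) X.
  by exists (measure_function_pushforward__canonical__measure_function_Measure mu mc).
rewrite -nuE -[c]/(NngNum cge0)%:num -/(mscale (NngNum cge0) nu A).
apply/esym.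
apply: (@lebesgue_measure_unique _ (mscale (NngNum cge0) nu)) => //= _ [[a b]] _ <-.
rewrite /mscale /= nuE /pushforward.
have -> : *%R c @^-1` [set` `]a, b]] = `](a / c)%R, (b / c)%R]%classic.
  apply/seteqP; split => x /=; rewrite !in_itv /= ltr_pdivrMr// ler_pdivlMr// (mulrC x) => //.
rewrite !lebesgue_measure_itv /= !lte_fin ltr_pM2r ?invr_gt0//.
case: ifP => ab; last by rewrite mule0.
by rewrite -EFinD -EFinM -mulrBl mulrCA divff ?gt_eqF// mulr1 EFinD.
Qed.

(** Change of variables through the pushforward of Lebesgue measure under multiplication by c, which
    is Lebesgue measure divided by c; the half-line is its own preimage. *)
Lemma ge0_integral_scale (c : R) (f : R -> \bar R) : (0 < c)%R ->
  measurable_fun (`]0%R, +oo[%classic : set R) f -> (forall x, (0 < x)%R -> 0 <= f x) ->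
  \int[mu]_(x in `]0%R, +oo[) f x =
  c%:E * \int[mu]_(x in `]0%R, +oo[) f (c * x)%R.
Proof.
move=> c0 mf f0; have cge0 : (0 <= c)%R by exact: ltW.
have mc : measurable_fun [set: measurableTypeR R]
  ( *%R c : measurableTypeR R -> measurableTypeR R) by exact: mulrl_measurable.
have preE : *%R c @^-1` `]0%R, +oo[%classic = (`]0%R, +oo[%classic : set R).
  by apply/seteqP; split => x /=; rewrite !in_itv /= !andbT pmulr_rgt0.
rewrite -[in RHS]preE -(@ge0_integral_pushforward _ _ (measurableTypeR R) (measurableTypeR R))//; last first.
  by move=> x /set_mem /=; rewrite in_itv/= andbT => /f0.
have [nu nuE] : exists nu : {measure set (measurableTypeR R) -> \bar R},
    forall X, nu X = pushforward mu ( *%R c : _ -> measurableTypeR R) X.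
  by exists (measure_function_pushforward__canonical__measure_function_Measure mu mc).
transitivity ((NngNum cge0)%:num%:E * \int[nu]_(x in `]0%R, +oo[) f x); last first.
  by congr (_ * _); apply: eq_measure_integral => A mA _; rewrite nuE.
rewrite -ge0_integral_mscale//; last by move=> x /=; rewrite in_itv/= andbT => /f0.
by apply: eq_measure_integral => A mA _; rewrite /= /mscale nuE lebesgue_measure_scale.
Qed.

End scaling.

Section power_integrals.
Variable R : realType.
Local Notation mu := (@lebesgue_measure R).

Lemma is_derive1_cvg (F : R -> R) (x d : R) :
  is_derive x 1 F d -> F y @[y --> x] --> F x.
Proof.
by move=> [dx _]; apply/differentiable_continuous; exact/derivable1_diffP.
Qed.

Lemma continuous_FTC2_is_derive (f F : R -> R) (a b : R) : a < b ->
  (forall x, a <= x <= b -> is_derive x 1 F (f x)) ->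
  {within `[a, b], continuous f} ->
  (\int[mu]_(x in `[a, b]) (f x)%:E = (F b - F a)%:E)%E.
Proof.
move=> ab dF cf.
have cF x : a <= x <= b -> F y @[y --> x] --> F x.
  by move=> /dF; exact: is_derive1_cvg.
rewrite (@continuous_FTC2 _ _ F _ _ ab cf) ?EFinB//.
- split.
  + by move=> x; rewrite in_itv/= => /andP[ax xb]; have [] := dF x; rewrite ?(ltW ax) ?(ltW xb).
  + by apply: cvg_at_right_filter; apply: cF; rewrite lexx ltW.
  + by apply: cvg_at_left_filter; apply: cF; rewrite lexx ltW.
- move=> x; rewrite in_itv/= => /andP[ax xb].
  by rewrite derive1E; have [] := dF x; rewrite ?(ltW ax) ?(ltW xb).
Qed.

Lemma continuous_powRr (c x : R) : 0 < x -> {for x, continuous (@powR R ^~ c)}.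
Proof.
move=> x0; apply/differentiable_continuous/derivable1_diffP.
by have [] := is_derive1_powR c x0.
Qed.

Lemma is_derive_powR_primitive (c x : R) : c + 1 != 0 -> 0 < x ->
  is_derive x 1 (fun y => y `^ (c + 1) / (c + 1)) (x `^ c).
Proof.
move=> c1 x0; have h := is_derive1_powR (c + 1) x0.
have -> : (fun y : R => y `^ (c + 1) / (c + 1)) = (c + 1)^-1 *: (@powR R ^~ (c + 1)).
  by apply/funext => y /=; rewrite mulrC.
apply: is_derive_eq.
by rewrite addrK scalerAl /GRing.scale /= mulVf// mul1r.
Qed.

(** For c < 0 the integrand blows up at 0, so the fundamental theorem is applied on compact
    subintervals and monotone convergence does the rest. *)
Lemma integral_powR01 (c : R) : -1 < c ->
  (\int[mu]_(x in `]0%R, 1%R]) (x `^ c)%:E = ((c + 1)^-1)%:E)%E.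
Proof.
move=> c1; have c10 : 0 < c + 1 by rewrite -ltrBlDr sub0r.
(* n + 2 rather than n + 1 keeps the left endpoint strictly below 1 already at n = 0. *)
pose F (n : nat) : set R := `[n.+2%:R^-1, 1]%classic.
have FE : (`]0, 1]%classic : set R) = \bigcup_n F n.
  apply/seteqP; split => [x/=|x [n _]]; rewrite /F/= !in_itv/=; last first.
    by move=> /andP[h ->]; rewrite (lt_le_trans _ h)// invr_gt0.
  move=> /andP[x0 x1]; exists (Num.Def.trunc x^-1) => //=; rewrite in_itv/= x1 andbT.
  rewrite invf_ple ?posrE ?invr_gt0//.
  rewrite (le_trans (ltW (truncnS_gt _)))// ler_nat//.
have mF : measurable_fun [set: R] (fun x : R => (x `^ c)%:E).
  by apply/measurable_EFinP; exact: measurable_powR.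
have h : (\int[mu]_(x in F i) (x `^ c)%:E @[i --> \oo] --> \int[mu]_(x in \bigcup_i F i) (x `^ c)%:E)%E.
  apply: ge0_nondecreasing_set_cvg_integral => //.
  - move=> n m nm; rewrite /F; apply/subsetPset => x /=; rewrite !in_itv/= => /andP[h ->].
    by rewrite andbT (le_trans _ h)// lef_pV2 ?posrE// ler_nat.
  - by move=> i; exact: measurable_itv.
  - by move=> i; apply: measurable_funTS.
  - by move=> i x _; rewrite lee_fin powR_ge0.
rewrite FE; apply: (cvg_unique _ h) => //=.
have -> : (fun i : nat => \int[mu]_(x in F i) (x `^ c)%:E)%E =
    EFin \o (fun i : nat => (1 - i.+2%:R^-1 `^ (c + 1)) / (c + 1)).
  apply/funext => i /=.
  have i0 : (0 : R) < i.+2%:R^-1 by rewrite invr_gt0.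
  transitivity (1 `^ (c + 1) / (c + 1) - i.+2%:R^-1 `^ (c + 1) / (c + 1))%:E;
    last by rewrite powR1 mulrBl.
  apply: (@continuous_FTC2_is_derive _ (fun y => y `^ (c + 1) / (c + 1))).
  - by rewrite invf_lt1// ltr1n.
  - by move=> x /andP[ix _]; apply: is_derive_powR_primitive; rewrite ?gt_eqF// (lt_le_trans i0).
  - apply: continuous_in_subspaceT => x /set_mem /=; rewrite in_itv/= => /andP[ix _].
    by apply: continuous_powRr; exact: lt_le_trans ix.
apply: cvg_EFin; first by near=> x.
suff : (1 - x.+2%:R^-1 `^ (c + 1)) / (c + 1) @[x --> \oo] --> (1 - 0) / (c + 1).
  by rewrite subr0 mul1r.
apply: cvgMl; apply: cvgB; first exact: cvg_cst.
have := powR_cvg0 c10 => /cvg_at_rightP; apply; split.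
  by move=> n; rewrite invr_gt0.
by have := @cvg_harmonic R; rewrite -cvg_shiftS.
Unshelve. all: end_near. Qed.

Lemma integral_powR1y (c : R) : c < -1 ->
  (\int[mu]_(x in `[1%R, +oo[) (x `^ c)%:E = (- (c + 1)^-1)%:E)%E.
Proof.
move=> c1; have c10 : c + 1 < 0 by rewrite -ltrBrDr sub0r.
rewrite (@ge0_continuous_FTC2y _ _ (fun y => y `^ (c + 1) / (c + 1)) 1 0).
- by rewrite powR1 -EFinB sub0r div1r.
- by move=> x _; exact: powR_ge0.
- apply: continuous_in_subspaceT => x /set_mem /=; rewrite in_itv/= andbT => x1.
  by apply: continuous_powRr; exact: lt_le_trans x1.
- rewrite -[X in _ --> X](mul0r (c + 1)^-1); apply: cvgMl.
  have c1' : 0 < - (c + 1) by rewrite oppr_gt0.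
  have -> : (fun x : R => x `^ (c + 1)) = (fun x => (x `^ (- (c + 1)))^-1).
    by apply/funext => x; rewrite -powRN opprK.
  apply/gtr0_cvgV0.
    by near=> x; apply: powR_gt0; near: x; exact: nbhs_pinfty_gt.
  apply/cvgryPge => A; near=> x.
  apply: (le_trans (ler_norm A)).
  have -> : `|A| = (`|A| `^ (- (c + 1))^-1) `^ (- (c + 1)).
    by rewrite -powRrM mulVf ?gt_eqF// powRr1.
  rewrite ge0_ler_powR ?nnegrE ?powR_ge0 ?(ltW c1')//.
- by move=> x x1; have [] := @is_derive_powR_primitive c x; rewrite ?lt_eqF// (lt_trans _ x1).
- apply: cvg_at_right_filter; apply: is_derive1_cvg.
  by apply: is_derive_powR_primitive; rewrite ?lt_eqF.
- move=> x; rewrite in_itv/= andbT => x1; rewrite derive1E.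
  by have [] := @is_derive_powR_primitive c x; rewrite ?lt_eqF// (lt_trans _ x1).
Unshelve. all: end_near. Qed.

Lemma integral_atan0y :
  (\int[mu]_(x in `[0%R, +oo[) ((1 + x ^+ 2)^-1)%:E)%E = (pi / 2 : R)%:E.
Proof.
rewrite (@ge0_continuous_FTC2y _ _ (@atan R) 0 (pi / 2)).
- by rewrite atan0 sube0.
- by move=> x _; rewrite invr_ge0 addr_ge0 ?sqr_ge0.
- by apply: continuous_subspaceT => x; exact: continuous_oneDsqrV.
- exact: cvgy_atan.
- by move=> x _; have [] := is_derive1_atan x.
- apply: cvg_at_right_filter; exact: continuous_atan.
- by move=> x _; rewrite derive1E; have [] := is_derive1_atan x.
Qed.

Lemma powR_oneDsqr_ge0 (c x : R) : 0 <= x `^ c / (1 + x ^+ 2).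
Proof. by rewrite divr_ge0 ?powR_ge0// addr_ge0 ?sqr_ge0. Qed.

Lemma measurable_powR_oneDsqr (c : R) (D : set R) :
  measurable_fun D (fun x : R => (x `^ c / (1 + x ^+ 2))%:E).
Proof.
apply/measurable_EFinP; apply: measurable_funTS; apply: measurable_funM.
  exact: measurable_powR.
apply: continuous_measurable_fun => x; exact: continuous_oneDsqrV.
Qed.

Lemma powR_oneDsqrD (c x : R) : 0 < x ->
  x `^ c / (1 + x ^+ 2) + x `^ (c + 2) / (1 + x ^+ 2) = x `^ c.
Proof.
move=> x0; rewrite powRD; last by rewrite (gt_eqF x0) implybT.
rewrite powR_mulrn ?ltW// -{1}[x `^ c]mulr1 -mulrDl -mulrDr mulfK//.
by rewrite gt_eqF// ltr_wpDr ?sqr_ge0.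
Qed.

(** Since x^c + x^(c+2) = x^c (1 + x^2), two integrals whose exponents differ by 2 add up to an
    elementary one. This is the recursion behind the alternating series. *)
Lemma integral_powR_oneDsqrD (D : set R) (c r : R) : measurable D ->
  (forall x, D x -> 0 < x) ->
  (\int[mu]_(x in D) (x `^ c)%:E = r%:E)%E ->
  (\int[mu]_(x in D) (x `^ c / (1 + x ^+ 2))%:E +
   \int[mu]_(x in D) (x `^ (c + 2) / (1 + x ^+ 2))%:E)%E = r%:E.
Proof.
move=> mD D0 <-; rewrite -ge0_integralD//.
- by apply: eq_integral => x /set_mem /D0 x0; rewrite -EFinD powR_oneDsqrD.
- by move=> x _; rewrite lee_fin powR_oneDsqr_ge0.
- exact: measurable_powR_oneDsqr.
- by move=> x _; rewrite lee_fin powR_oneDsqr_ge0.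
- exact: measurable_powR_oneDsqr.
Qed.

Lemma alternating_series_cvg (u a : R^nat) :
  (forall n, u n + u n.+1 = a n) -> u n @[n --> \oo] --> 0 ->
  (\sum_(n < N) (-1) ^+ n * a n) @[N --> \oo] --> u 0%N.
Proof.
move=> ua u0.
(* Telescoping leaves u 0 and a signed remainder. *)
have -> : (fun N => \sum_(n < N) (-1) ^+ n * a n) = (fun N => u 0%N - (-1) ^+ N * u N).
  apply/funext; elim => [|N IH]; first by rewrite big_ord0 expr0 mul1r subrr.
  by rewrite big_ord_recr/= IH -ua exprS; ring.
rewrite -[X in _ --> X]subr0; apply: cvgB; first exact: cvg_cst.
apply/norm_cvg0P.
under eq_fun do rewrite normrM normrX normrN1 expr1n mul1r.
exact/norm_cvg0P.
Qed.

(** Nonnegativity gives U n <= a n, hence both finiteness and convergence of U n to 0. The series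
    for U 0 then telescopes, with no exchange of sum and integral. *)
Lemma alternating_integral (U : (\bar R)^nat) (a : R^nat) :
  (forall n, 0 <= U n)%E -> (forall n, U n + U n.+1 = (a n)%:E)%E ->
  a n @[n --> \oo] --> 0 ->
  U 0%N \is a fin_num /\
  (\sum_(n < N) (-1) ^+ n * a n) @[N --> \oo] --> fine (U 0%N).
Proof.
move=> U0 Ua a0.
have Uf n : U n \is a fin_num.
  rewrite ge0_fin_numE// (@le_lt_trans _ _ (a n)%:E) ?ltry// -Ua leeDl//.
split => //; apply: (@alternating_series_cvg (fine \o U)) => [n|].
  by apply: EFin_inj; rewrite EFinD/= !fineK.
apply: (@squeeze_cvgr _ _ _ _ (cst 0) a) => //; last exact: cvg_cst.
near=> n; rewrite /= fine_ge0//= -lee_fin fineK// -Ua leeDl//.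
Unshelve. all: end_near. Qed.

Lemma cvg_inv_arith (s : R) : (2 * n%:R + s)^-1 @[n --> \oo] --> (0 : R).
Proof.
apply/gtr0_cvgV0.
  near=> n.
  have : (`|s| + 1 <= n%:R) by near: n; exact: nbhs_infty_ger.
  have := ler_norm (- s); rewrite normrN; have := ler0n R n; lra.
apply/cvgryPge => A; near=> n.
have : (`|s| + `|A| <= n%:R) by near: n; exact: nbhs_infty_ger.
have := ler_norm (- s); have := ler_norm A; rewrite normrN; have := ler0n R n; lra.
Unshelve. all: end_near. Qed.

(** The recursion is run with exponents s + 2n, whose pair sums are the integrals 1 / (2n + s + 1)
    of x^(s + 2n) over ]0, 1]. *)
Lemma cvg_integral_powR_oneDsqr01 (s : R) : -1 < s ->
  (\int[mu]_(x in `]0%R, 1%R]) (x `^ s / (1 + x ^+ 2))%:E)%E \is a fin_num /\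
  (\sum_(n < N) (-1) ^+ n * (2 * n%:R + (s + 1))^-1) @[N --> \oo] -->
  fine (\int[mu]_(x in `]0%R, 1%R]) (x `^ s / (1 + x ^+ 2))%:E)%E.
Proof.
move=> s1.
have := @alternating_integral
  (fun n => \int[mu]_(x in `]0%R, 1%R]) (x `^ (s + 2 * n%:R) / (1 + x ^+ 2))%:E)%E
  (fun n => (2 * n%:R + (s + 1))^-1).
rewrite mulr0 addr0; apply.
- by move=> n; apply: integral_ge0 => x _; rewrite lee_fin powR_oneDsqr_ge0.
- move=> n.
  have -> : s + 2 * n.+1%:R = (s + 2 * n%:R) + 2 by rewrite -natr1; ring.
  apply: integral_powR_oneDsqrD => //.
    by move=> x /=; rewrite in_itv/= => /andP[].
  rewrite integral_powR01 ?(lt_le_trans s1) ?lerDl ?mulr_ge0//.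
  by congr (_^-1%:E); ring.
- exact: cvg_inv_arith.
Qed.

(** On [1, +oo[ the exponents s - 2n go down, so that the pair sums stay integrable at infinity and
    tend to 0. *)
Lemma cvg_integral_powR_oneDsqr1y (s : R) : s < 1 ->
  (\int[mu]_(x in `[1%R, +oo[) (x `^ s / (1 + x ^+ 2))%:E)%E \is a fin_num /\
  (\sum_(n < N) (-1) ^+ n * (2 * n%:R + (1 - s))^-1) @[N --> \oo] -->
  fine (\int[mu]_(x in `[1%R, +oo[) (x `^ s / (1 + x ^+ 2))%:E)%E.
Proof.
move=> s1.
have := @alternating_integral
  (fun n => \int[mu]_(x in `[1%R, +oo[) (x `^ (s - 2 * n%:R) / (1 + x ^+ 2))%:E)%E
  (fun n => (2 * n%:R + (1 - s))^-1).
rewrite mulr0 subr0; apply.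
- by move=> n; apply: integral_ge0 => x _; rewrite lee_fin powR_oneDsqr_ge0.
- move=> n; rewrite addeC.
  have -> : s - 2 * n%:R = (s - 2 * n.+1%:R) + 2 by rewrite -natr1; ring.
  have n0 : (0 : R) <= n%:R by [].
  apply: integral_powR_oneDsqrD => //.
    by move=> x /=; rewrite in_itv/= andbT => /(lt_le_trans _); apply.
  rewrite integral_powR1y; last by rewrite -natr1; lra.
  by congr (_%:E); rewrite -invrN; congr (_^-1); rewrite -natr1; ring.
- exact: cvg_inv_arith.
Qed.

Lemma integral_powR_oneDsqr_split (s : R) :
  (\int[mu]_(x in `]0%R, +oo[) (x `^ s / (1 + x ^+ 2))%:E =
  \int[mu]_(x in `]0%R, 1%R]) (x `^ s / (1 + x ^+ 2))%:E +
  \int[mu]_(x in `[1%R, +oo[) (x `^ s / (1 + x ^+ 2))%:E)%E.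
Proof.
rewrite -(@integral_itv_obnd_cbnd _ 1); last exact: measurable_powR_oneDsqr.
have -> : (`]0%R, +oo[%classic : set R) = `]0%R, 1%R] `|` `]1%R, +oo[.
  by rewrite -itv_bndbnd_setU// bnd_simp.
rewrite ge0_integral_setU//.
- exact: measurable_powR_oneDsqr.
- by move=> x _; rewrite lee_fin powR_oneDsqr_ge0.
- apply/disj_setPS => x [] /=; rewrite !in_itv/= => /andP[_ x1]; rewrite andbT => /(le_lt_trans x1).
  by rewrite ltxx.
Qed.

End power_integrals.

(** * The integral of x^s / (1 + x^2) over the half-line *)

Section secant_series.
Variable R : realType.

(* Expanding 1 / (1 + x^2) geometrically on ]0, 1] and on [1, +oo[ yields, for
   the integral of x^s / (1 + x^2), the limit of [sec_primitive s N (pi / 2)]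
   divided by cos (s pi / 2).  The difference with the case s = 0 (an arctangent)
   is handled by differentiating in x: the derivatives have a common Dirichlet
   factor, whose Cesaro sums form a bounded Fejer-type kernel. *)
Definition sec_primitive (s : R) (N : nat) (x : R) : R :=
  \sum_(n < N) (sin ((2 * n%:R + (s + 1)) * x) / (2 * n%:R + (s + 1)) +
                sin ((2 * n%:R + (1 - s)) * x) / (2 * n%:R + (1 - s))).

(** The Dirichlet-type kernel sin(2Nx) / sin x, written without a quotient. *)
Definition odd_cos_sum (N : nat) (x : R) : R :=
  \sum_(n < N) 2 * cos ((2 * n%:R + 1) * x).

Lemma is_derive_sin_scale (a x : R) : a != 0 ->
  is_derive x 1 (fun y => sin (a * y) / a) (cos (a * x)).
Proof.
move=> a0; have -> : (fun y => sin (a * y) / a) = a^-1 *: (@sin R \o ( *%R a)).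
  by apply/funext => y /=; rewrite mulrC.
apply: is_derive_eq.
by rewrite /GRing.scale/= !mulr1 mulrCA mulVf// mulr1.
Qed.

(** The frequencies (2n + 1) + s and (2n + 1) - s pair up: their cosines add to 2 cos((2n + 1)x)
    cos(sx), and s leaves the sum. *)
Lemma is_derive_sec_primitive (s : R) (N : nat) (x : R) : -1 < s < 1 ->
  is_derive x 1 (sec_primitive s N) (cos (s * x) * odd_cos_sum N x).
Proof.
move=> /andP[s1 s2].
rewrite (_ : sec_primitive s N = \sum_(n < N)
    ((fun x => sin ((2 * n%:R + (s + 1)) * x) / (2 * n%:R + (s + 1))) +
     (fun x => sin ((2 * n%:R + (1 - s)) * x) / (2 * n%:R + (1 - s))))); last first.
  by apply/funext => y; rewrite /sec_primitive fct_sumE.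
rewrite /odd_cos_sum mulr_sumr; apply: is_derive_sum => n.
have n0 : (0 : R) <= n%:R by [].
have h1 := @is_derive_sin_scale (2 * n%:R + (s + 1)) x.
have h2 := @is_derive_sin_scale (2 * n%:R + (1 - s)) x.
have {}h1 := h1 ltac:(apply/eqP; lra).
have {}h2 := h2 ltac:(apply/eqP; lra).
apply: is_derive_eq.
have -> : (2 * n%:R + (s + 1)) * x = (2 * n%:R + 1) * x + s * x by ring.
have -> : (2 * n%:R + (1 - s)) * x = (2 * n%:R + 1) * x - s * x by ring.
by rewrite cosD cosB; ring.
Qed.

Lemma sin_pihalf_odd (n : nat) (s : R) :
  sin ((2 * n%:R + (s + 1)) * (pi / 2)) = (-1) ^+ n * cos (s * (pi / 2)).
Proof.
elim: n => [|n IH].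
  by rewrite mulr0 add0r expr0 mul1r mulrDl mul1r sinDpihalf.
rewrite (_ : _ * _ = (2 * n%:R + (s + 1)) * (pi / 2) + pi).
  by rewrite sinDpi IH exprS; ring.
by rewrite -natr1; field.
Qed.

Lemma sec_primitive_pihalf (s : R) (N : nat) :
  sec_primitive s N (pi / 2) = cos (s * (pi / 2)) *
  (\sum_(n < N) (-1) ^+ n * (2 * n%:R + (s + 1))^-1 +
   \sum_(n < N) (-1) ^+ n * (2 * n%:R + (1 - s))^-1).
Proof.
rewrite /sec_primitive -big_split mulr_sumr; apply: eq_bigr => n _ /=.
rewrite sin_pihalf_odd (_ : 1 - s = - s + 1) ?sin_pihalf_odd; last by rewrite addrC.
by rewrite mulNr cosN; ring.
Qed.

Lemma odd_cos_sum_sin (N : nat) (x : R) : odd_cos_sum N x * sin x = sin (2 * N%:R * x).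
Proof.
elim: N => [|N IH]; first by rewrite /odd_cos_sum big_ord0 mulr0 mul0r mul0r sin0.
rewrite /odd_cos_sum big_ord_recr/= mulrDl -/(odd_cos_sum N x) IH.
rewrite (_ : 2 * N.+1%:R * x = (2 * N%:R + 1) * x + x); last by rewrite -natr1; ring.
rewrite (_ : 2 * N%:R * x = (2 * N%:R + 1) * x - x); last by ring.
by rewrite sinB sinD; ring.
Qed.

(** Summing the Dirichlet numerators once more gives the numerator of the Fejer-type kernel, a
    product of two sines bounded by 1. *)
Lemma sum_sin_even (M : nat) (x : R) :
  (\sum_(m < M.+1) sin (2 * m%:R * x)) * sin x = sin (M%:R * x) * sin ((M%:R + 1) * x).
Proof.
elim: M => [|M IH]; first by rewrite big_ord_recr big_ord0/= mulr0 !mul0r sin0 addr0 !mul0r.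
rewrite big_ord_recr/= mulrDl IH.
rewrite (_ : (M.+1%:R + 1) * x = (M%:R + 1) * x + x); last by rewrite -natr1; ring.
rewrite (_ : M%:R * x = (M%:R + 1) * x - x); last by ring.
rewrite (_ : 2 * M.+1%:R * x = (M%:R + 1) * x + (M%:R + 1) * x); last by rewrite -natr1; ring.
rewrite (_ : M.+1%:R * x = (M%:R + 1) * x); last by rewrite -natr1.
by rewrite sinB !sinD; ring.
Qed.

(** The summed kernels equal sin(Mx) sin((M + 1)x) / sin^2 x. The singularity at 0 is cancelled by 0
    <= 1 - cos(sx) <= 1 - cos x <= sin^2 x, valid for |s| < 1 and cos x >= 0. *)
Lemma fejer_bound (s x : R) (M : nat) : -1 < s < 1 -> 0 < x < pi / 2 ->
  `|(cos (s * x) - 1) * \sum_(m < M.+1) odd_cos_sum m x| <= 1.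
Proof.
move=> /andP[s1 s2] /andP[x0 xpi].
have pi0 : (0 : R) < pi := pi_gt0 R.
have sx : 0 < sin x by apply: sin_gt0_pi; rewrite ?in_itv/=; apply/andP; split; lra.
have cx : 0 <= cos x by apply: cos_ge0_pihalf; apply/andP; split; lra.
have h1 : 0 <= 1 - cos (s * x) <= sin x ^+ 2.
  rewrite subr_ge0 cos_le1/=.
  have h : cos x <= cos (s * x).
    rewrite -[leRHS]cos_norm.
    have sx1 : `|s * x| <= x by rewrite normrM (gtr0_norm x0) ler_piMl ?ltW// ltr_norml s1.
    by rewrite leNgt ltr_cos ?in_itv/= -?leNgt//; apply/andP; split => //; lra.
  have := sin2cos2 x; have := cos_le1 x; nra.
have sn : sin x ^+ 2 * \sum_(m < M.+1) odd_cos_sum m x = sin (M%:R * x) * sin ((M%:R + 1) * x).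
  rewrite -sum_sin_even expr2 -mulrA mulrC; congr (_ * _).
  by rewrite mulr_sumr; apply: eq_bigr => m _; rewrite mulrC odd_cos_sum_sin.
have sn1 : `|sin x ^+ 2 * \sum_(m < M.+1) odd_cos_sum m x| <= 1.
  by rewrite sn normrM mulr_ile1// sin_max.
apply: le_trans sn1; rewrite !normrM ler_wpM2r// distrC.
case/andP: h1 => h1 h2; by rewrite (ger0_norm h1) -expr2 real_normK ?num_real.
Qed.

(** A convergent sequence has the same limit as its Cesaro means, which are here at most C / (n + 1)
    in absolute value. *)
Lemma bounded_partial_sums_lim0 (d : R^nat) (l C : R) :
  (forall M, `|\sum_(m < M.+1) d m| <= C) -> d n @[n --> \oo] --> l -> l = 0.
Proof.
move=> bd dl.
have h0 : (fun n => C * harmonic n) @ \oo --> 0.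
  by rewrite -(mulr0 C); apply: cvgMr; exact: cvg_harmonic.
apply: (cvg_unique _ (cesaro dl)) => //.
apply/norm_cvg0P; apply: (@squeeze_cvgr _ _ _ _ (cst 0) (fun n => C * harmonic n)) => //.
  near=> n; rewrite normr_ge0/= /arithmetic_mean/= /series/= big_mkord.
  by rewrite normrM ger0_norm// mulrC ler_wpM2r.
exact: cvg_cst.
Unshelve. all: end_near. Qed.

(** The sum vanishes at 0 and its derivative is at most 1 in absolute value on ]0, pi/2[, uniformly
    in M; the mean value theorem concludes. *)
Lemma sec_primitive_sum_bound (s : R) (M : nat) : -1 < s < 1 ->
  `|\sum_(m < M.+1) (sec_primitive s m (pi / 2) - sec_primitive 0 m (pi / 2))| <= pi / 2.
Proof.
move=> s1; have pi0 : (0 : R) < pi / 2 by rewrite divr_gt0 ?pi_gt0.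
pose F (x : R) : R := \sum_(m < M.+1) (sec_primitive s m x - sec_primitive 0 m x).
have dF (x : R) : is_derive x 1 F ((cos (s * x) - 1) * \sum_(m < M.+1) odd_cos_sum m x).
  rewrite (_ : F = \sum_(m < M.+1) (sec_primitive s m - sec_primitive 0 m)); last first.
    by apply/funext => y; rewrite /F fct_sumE.
  rewrite mulr_sumr; apply: is_derive_sum => m.
  have h1 := is_derive_sec_primitive m x s1.
  have h2 := @is_derive_sec_primitive 0 m x.
  have {}h2 := h2 ltac:(by rewrite ltrN10 ltr01).
  by apply: is_derive_eq; rewrite mul0r cos0 -mulrBl.
have F0 : F 0 = 0.
  by rewrite /F big1// => m _; rewrite /sec_primitive !big1 ?subrr// => n _; rewrite !mulr0 sin0 !mul0r addr0.
have [] := @MVT _ F (fun x => (cos (s * x) - 1) * \sum_(m < M.+1) odd_cos_sum m x) _ _ pi0.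
  by apply: derivable_within_continuous => x _; have [] := dF x.
move=> x; rewrite in_itv/= F0 !subr0 => xpi FE.
rewrite -[X in `|X|]/(F (pi / 2)) FE.
by rewrite normrM (gtr0_norm pi0) ler_piMl ?(ltW pi0) ?fejer_bound.
Qed.

(** For each exponent r, [sec_primitive] at pi/2 converges to cos(r pi/2) J(r). The differences with
    r = 0 have bounded partial sums, so the limits coincide, and J(0) = pi/2 is the arctangent
    integral. *)
Lemma integral_powR_oneDsqr (s : R) : -1 < s < 1 ->
  (\int[lebesgue_measure]_(x in `]0%R, +oo[) (x `^ s / (1 + x ^+ 2))%:E)%E =
  (pi / 2 / cos (s * (pi / 2)))%:E.
Proof.
move=> s11; pose J (r : R) := (\int[lebesgue_measure]_(x in `]0%R, +oo[) (x `^ r / (1 + x ^+ 2))%:E)%E.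
have key (r : R) : -1 < r < 1 -> J r \is a fin_num /\
    sec_primitive r n (pi / 2) @[n --> \oo] --> cos (r * (pi / 2)) * fine (J r).
  move=> /andP[r1 r2]; rewrite /J integral_powR_oneDsqr_split.
  have [f1 c1] := cvg_integral_powR_oneDsqr01 r1.
  have [f2 c2] := cvg_integral_powR_oneDsqr1y r2.
  rewrite fin_numD f1 f2; split => //.
  rewrite fineD//; under eq_fun do rewrite sec_primitive_pihalf.
  by apply: cvgMr; apply: cvgD.
have [fs cs] := key s s11.
have [f0 c0] := key 0 ltac:(by rewrite ltrN10 ltr01).
have J0 : fine (J 0) = pi / 2.
  apply: EFin_inj; rewrite fineK// -integral_atan0y /J.
  rewrite -integral_itv_obnd_cbnd; last first.
    apply/measurable_EFinP; apply: measurable_funTS.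
    apply: continuous_measurable_fun => x; exact: continuous_oneDsqrV.
  by apply: eq_integral => x _; rewrite powRr0 div1r.
have cE : cos (s * (pi / 2)) * fine (J s) - cos (0 * (pi / 2)) * fine (J 0) = 0.
  apply: (@bounded_partial_sums_lim0
    (fun m => sec_primitive s m (pi / 2) - sec_primitive 0 m (pi / 2)) _ (pi / 2)).
    by move=> M; exact: sec_primitive_sum_bound.
  exact: cvgB.
have c_gt0 : 0 < cos (s * (pi / 2)).
  have pi0 := pi_gt0 R; case/andP: s11 => s1 s2.
  by apply: cos_gt0_pihalf; apply/andP; split; nra.
rewrite -/(J s) -(fineK fs); congr (_%:E).
move: cE; rewrite mul0r cos0 mul1r J0 => /eqP; rewrite subr_eq0 => /eqP cE.
set c := cos _ in c_gt0 cE *.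
by rewrite -cE mulrAC divff ?mul1r// gt_eqF.
Qed.

End secant_series.

(** * The constant of the harmonizable representation *)

Section fbm_constant.
Variable R : realType.
Local Notation mu := (@lebesgue_measure R).
Implicit Types H t w : R.

Definition fbm_weight H w : R := w `^ (- 1 - 2 * H).

(** Half of |e^{itw} - 1|^2 times the weight. *)
Definition cos_defect H t w : R := (1 - cos (t * w)) * fbm_weight H w.

Lemma cos_defect_ge0 H t w : 0 <= cos_defect H t w.
Proof. by rewrite mulr_ge0 ?powR_ge0// subr_ge0 cos_le1. Qed.

Lemma measurable_cos_scale t : measurable_fun [set: R] (fun w => cos (t * w)).
Proof.
apply: continuous_measurable_fun => x.
by apply: (@continuous_comp _ _ _ ( *%R t) cos); [exact: mulrl_continuous|exact: continuous_cos].
Qed.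

Lemma measurable_cos_defect H t (D : set R) :
  measurable_fun D (cos_defect H t).
Proof.
apply: measurable_funTS; apply: measurable_funM.
  apply: measurable_funB => //; exact: measurable_cos_scale.
exact: measurable_powR.
Qed.

(** Substitute tw for w in the integral with t = 1. The identity is stated in the extended reals
    because finiteness is established only in [fbm_constant]. *)
Lemma integral_cos_defect_scale H t : 0 < t ->
  (\int[mu]_(w in `]0%R, +oo[) (cos_defect H t w)%:E =
  (t `^ (2 * H))%:E * \int[mu]_(w in `]0%R, +oo[) (cos_defect H 1 w)%:E)%E.
Proof.
move=> t0; rewrite (@ge0_integral_scale _ t (fun w => (cos_defect H 1 w)%:E))//; last 2 first.
- by apply/measurable_EFinP; exact: measurable_cos_defect.
- by move=> x _; rewrite lee_fin cos_defect_ge0.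
rewrite muleA -EFinM.
under [in RHS]eq_integral => x.
  rewrite inE/= in_itv/= andbT => x0.
  have -> : (cos_defect H 1 (t * x))%:E = ((t `^ (- 1 - 2 * H))%:E * (cos_defect H t x)%:E)%E.
    rewrite /cos_defect mul1r /fbm_weight powRM ?ltW// -EFinM; congr (_%:E); ring.
  over.
rewrite ge0_integralZl//; last 3 first.
- by apply/measurable_EFinP; exact: measurable_cos_defect.
- by move=> x _; rewrite lee_fin cos_defect_ge0.
- by rewrite lee_fin powR_ge0.
rewrite muleA -EFinM.
have -> : t `^ (2 * H) * t * t `^ (- 1 - 2 * H) = 1.
  rewrite -{2}(powRr1 (ltW t0)) -!powRD ?(gt_eqF t0) ?implybT//.
  by rewrite (_ : _ + _ = 0) ?powRr0//; ring.
by rewrite mul1e.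
Qed.

Lemma continuous_laplace_kernel w :
  continuous (fun t : R => expR (- t) * (1 - cos (t * w))).
Proof.
move=> x; have h : is_derive x 1 (fun t => expR (- t) * (1 - cos (t * w)))
    (expR (- x) * (w * sin (x * w) - (1 - cos (x * w)))).
  by apply: is_derive_eq; rewrite /GRing.scale/=; ring.
exact: is_derive1_cvg h.
Qed.

Lemma laplace_one_minus_cos w :
  (\int[mu]_(t in `[0%R, +oo[) (expR (- t) * (1 - cos (t * w)))%:E)%E =
  (w ^+ 2 / (1 + w ^+ 2))%:E.
Proof.
have w0 : 0 < 1 + w ^+ 2 by rewrite ltr_wpDr ?sqr_ge0.
(* The primitive of e^{-t} (1 - cos(tw)) that vanishes at infinity. *)
pose F (t : R) : R := expR (- t) * ((cos (t * w) - w * sin (t * w)) / (1 + w ^+ 2) - 1).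
have dF (t : R) : is_derive t 1 F (expR (- t) * (1 - cos (t * w))).
  rewrite /F; apply: is_derive_eq; rewrite /GRing.scale/=; field.
  by rewrite gt_eqF.
rewrite (@ge0_continuous_FTC2y _ _ F 0 0).
- rewrite -EFinB; congr (_%:E); rewrite /F oppr0 expR0 mul0r cos0 sin0; field.
  by rewrite gt_eqF.
- by move=> x _; rewrite mulr_ge0 ?expR_ge0// subr_ge0 cos_le1.
- apply: continuous_subspaceT; exact: continuous_laplace_kernel.
- apply/norm_cvg0P.
  pose C := (1 + `|w|) / (1 + w ^+ 2) + 1.
  apply: (@squeeze_cvgr _ _ _ _ (cst 0) (fun t => expR (- t) * C)).
  + near=> t; rewrite normr_ge0/= /F normrM (ger0_norm (expR_ge0 _)) ler_wpM2l ?expR_ge0//.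
    rewrite (le_trans (ler_normB _ _))// normr1 lerD2r normrM [`|_^-1|]ger0_norm ?invr_ge0 ?(ltW w0)//.
    rewrite ler_wpM2r ?invr_ge0 ?(ltW w0)// (le_trans (ler_normB _ _))// normrM.
    by rewrite lerD ?cos_max// ler_piMr ?sin_max.
  + exact: cvg_cst.
  + rewrite -(mul0r C); apply: cvgMl; exact: cvgr_expR.
- by move=> x _; have [] := dF x.
- by apply: cvg_at_right_filter; apply: is_derive1_cvg (dF 0).
- by move=> x _; rewrite derive1E; have [] := dF x.
Unshelve. all: end_near. Qed.

Let pos : set R := `]0%R, +oo[%classic.

(* By scaling, the inner integral on the left is k t^(2H), so the left-hand side
   is k Gamma (2 H + 1). *)
Lemma tonelli_cos_defect H :
  (\int[mu]_(t in pos) ((expR (- t))%:E * \int[mu]_(w in pos) (cos_defect H t w)%:E) =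
  \int[mu]_(w in pos) (w `^ (1 - 2 * H) / (1 + w ^+ 2))%:E)%E.
Proof.
have mpos : measurable pos by exact: measurable_itv.
(* The indicators extend the integrand to the whole plane, where Tonelli's theorem is applied. *)
pose g (z : R * R) : \bar R :=
  (expR (- z.1) * \1_pos z.1 * \1_pos z.2 * (1 - cos (z.1 * z.2)) * fbm_weight H z.2)%:E.
have mexpN : measurable_fun [set: R] (fun t : R => expR (- t)).
  apply: continuous_measurable_fun => x.
  by apply: (@continuous_comp _ _ _ -%R expR); [exact: opp_continuous|exact: continuous_expR].
have mg : measurable_fun setT g.
  apply/measurable_EFinP; apply: measurable_funM; last first.
    apply: (measurableT_comp (f := fbm_weight H)) => //; exact: measurable_powR.
  apply: measurable_funM; last first.
    apply: measurable_funB => //.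
    apply: (measurableT_comp (f := @cos R)); last exact: measurable_funM.
    by apply: continuous_measurable_fun; exact: continuous_cos.
  apply: measurable_funM; last exact: (measurableT_comp (f := (\1_pos : R -> R))).
  apply: measurable_funM; last exact: (measurableT_comp (f := (\1_pos : R -> R))).
  exact: (measurableT_comp mexpN).
have g0 z : (0 <= g z)%E.
  by rewrite lee_fin !mulr_ge0 ?expR_ge0 ?powR_ge0// subr_ge0 cos_le1.
transitivity (\int[mu]_t \int[mu]_w g (t, w))%E.
  rewrite integral_mkcond; apply: eq_integral => t _.
  rewrite epatch_indic /g/=.
  transitivity (\int[mu]_w ((expR (- t) * \1_pos t)%:E *
      (\1_pos w * cos_defect H t w)%:E))%E; last first.
    by apply: eq_integral => w _; rewrite -EFinM /cos_defect; congr (_%:E); ring.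
  rewrite ge0_integralZl//; last 2 first.
  - apply/measurable_EFinP; apply: measurable_funM; first exact: measurable_indic.
    exact: measurable_cos_defect.
  - by move=> w _; rewrite lee_fin mulr_ge0 ?cos_defect_ge0.
  rewrite EFinM -!muleA; congr (_ * _)%E; rewrite muleC; congr (_ * _)%E.
  rewrite [LHS]integral_mkcond; apply: eq_integral => w _.
  by rewrite epatch_indic /= -EFinM mulrC.
rewrite fubini_tonelli// [RHS]integral_mkcond; apply: eq_integral => w _.
rewrite epatch_indic /g/=.
have [wp|wp] := boolP (w \in pos); last first.
  rewrite indicE (negbTE wp) mule0; apply: integral0_eq => t _.
  by rewrite /= mulr0 !mul0r.
rewrite [\1_pos w]indicE wp mule1.
(* At fixed w > 0 the integral over t is the Laplace transform w^2 / (1 + w^2), and the weight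
   factors out. *)
transitivity ((fbm_weight H w)%:E * \int[mu]_(t in `[0%R, +oo[) (expR (- t) * (1 - cos (t * w)))%:E)%E; last first.
  rewrite laplace_one_minus_cos -EFinM; congr (_%:E).
  move: wp; rewrite inE/pos/= in_itv/= andbT => w0.
  rewrite mulrA; congr (_ / _).
  rewrite -(powR_mulrn _ (ltW w0)) -powRD ?(gt_eqF w0) ?implybT//.
  by congr (_ `^ _); ring.
have mF : measurable_fun [set: R] (fun t => (expR (- t) * (1 - cos (t * w)))%:E).
  apply/measurable_EFinP; apply: continuous_measurable_fun.
  exact: continuous_laplace_kernel.
have F0 t : (0 <= (expR (- t) * (1 - cos (t * w)))%:E)%E.
  by rewrite lee_fin mulr_ge0 ?expR_ge0// subr_ge0 cos_le1.
rewrite -integral_itv_obnd_cbnd; last exact: measurable_funTS.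
rewrite -ge0_integralZl//; last 2 first.
- exact: measurable_funTS.
- by rewrite lee_fin powR_ge0.
rewrite [RHS]integral_mkcond; apply: eq_integral => t _.
by rewrite epatch_indic -/pos -!EFinM; congr (_%:E); rewrite mulr1; ring.
Qed.

(** Tonelli's identity evaluates the product of the Gamma integral and of K. This product is finite
    and positive and both factors are nonnegative, so neither can be infinite or zero. *)
Lemma fbm_constant H : 0 < H < 1 -> exists2 k : R, 0 < k &
  (\int[mu]_(w in pos) (cos_defect H 1 w)%:E)%E = k%:E /\
  k * Gamma (2 * H + 1) * sin (pi * H) = pi / 2.
Proof.
move=> /andP[H0 H1]; set K := (\int[mu]_(w in pos) _)%E.
have mpos : measurable pos by exact: measurable_itv.
pose G := (\int[mu]_(t in pos) (t `^ (2 * H + 1 - 1) * expR (- t))%:E)%E.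
have K0 : (0 <= K)%E by apply: integral_ge0 => x _; rewrite lee_fin cos_defect_ge0.
have G0 : (0 <= G)%E by apply: integral_ge0 => x _; rewrite lee_fin mulr_ge0 ?powR_ge0 ?expR_ge0.
have s0 : 0 < sin (pi * H).
  have pi0 := pi_gt0 R.
  by apply: sin_gt0_pi; rewrite ?in_itv/=; apply/andP; split; nra.
have KG : (G * K = (pi / 2 / sin (pi * H))%:E)%E.
  rewrite /G -ge0_integralZr//; last 2 first.
  - apply/measurable_EFinP; apply: measurable_funTS; apply: measurable_funM.
      exact: measurable_powR.
    apply: continuous_measurable_fun => x.
    by apply: (@continuous_comp _ _ _ -%R expR); [exact: opp_continuous|exact: continuous_expR].
  - by move=> x _; rewrite lee_fin mulr_ge0 ?powR_ge0 ?expR_ge0.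
  transitivity (\int[mu]_(t in pos) ((expR (- t))%:E * \int[mu]_(w in pos) (cos_defect H t w)%:E))%E.
    apply: eq_integral => t; rewrite inE/pos/= in_itv/= andbT => t0.
    rewrite integral_cos_defect_scale// addrK [(t `^ _ * _)%R]mulrC EFinM muleA//.
  rewrite tonelli_cos_defect integral_powR_oneDsqr; last by apply/andP; split; lra.
  congr ((_ / _)%:E).
  (* The secant becomes 1 / sin(pi H). *)
  have -> : (1 - 2 * H) * (pi / 2) = pi / 2 - pi * H :> R by field.
  by rewrite cosB cos_pihalf sin_pihalf mul0r mul1r add0r.
have c0 : 0 < pi / 2 / sin (pi * H) by rewrite !divr_gt0 ?pi_gt0.
(* [Gamma] is a real-valued integral, with default value 0 when infinite; finiteness of [G] makes it
   the true value. *)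
have [k [g [KE GE]]] : exists k g, K = k%:E /\ G = g%:E.
  move: K K0 G G0 KG => [k||] // K0 [g||] // G0.
  - by move=> _; exists k, g.
  - move: K0; rewrite lee_fin le_eqVlt => /predU1P[<-|k0 h].
      by rewrite mule0 => -[] h; move: c0; rewrite -h ltxx.
    by move: h; rewrite gt0_mulye.
  - move: G0; rewrite lee_fin le_eqVlt => /predU1P[<-|g0 h].
      by rewrite mul0e => -[] h; move: c0; rewrite -h ltxx.
    by move: h; rewrite gt0_muley.
have kg : g * k = pi / 2 / sin (pi * H) by apply: EFin_inj; rewrite EFinM -KE -GE.
have k0 : 0 < k.
  rewrite lt_neqAle -lee_fin -KE K0 andbT; apply: contraTneq c0 => k0.
  by rewrite -kg -k0 mulr0 ltxx.
exists k => //; split => //.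
have -> : Gamma (2 * H + 1) = g by rewrite /Gamma /Rintegral -/pos -/G GE.
by rewrite mulrC [k * g]mulrC kg mulrC divfK// gt_eqF.
Qed.

End fbm_constant.

(** * Matrix exponentials of stable matrices *)

Section matrix_exponential.
Variables (R : realType) (p' : nat).
Local Notation p := p'.+1.
Implicit Types (A M : 'M[R]_p) (t : R).

Lemma cvg_sumr (I : Type) (r : seq I) (T : Type) (F : set_system T) {FF : Filter F}
    (f : I -> T -> R) (l : I -> R) :
  (forall i, f i x @[x --> F] --> l i) ->
  \sum_(i <- r) f i x @[x --> F] --> \sum_(i <- r) l i.
Proof.
move=> fl; elim: r => [|i r IH].
  by rewrite big_nil; under eq_fun do rewrite big_nil; exact: cvg_cst.
by rewrite big_cons; under eq_fun do rewrite big_cons; apply: cvgD.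
Qed.

Lemma mx_cvg (F : nat -> 'M[R]_p) (L : 'M[R]_p) :
  (forall i j, F n i j @[n --> \oo] --> L i j) -> F n @[n --> \oo] --> L.
Proof.
move=> FL; apply/cvgrPdist_lt => e e0.
have : \forall n \near \oo, forall ij : 'I_p * 'I_p, `|L ij.1 ij.2 - F n ij.1 ij.2| < e.
  apply: filter_forall => -[i j].
  by have /cvgrPdist_lt/(_ _ e0) := FL i j.
apply: filterS => n Fn; rewrite -[ltLHS]/(mx_norm (L - F n)) mx_normrE; apply/bigmax_ltP; split => // ij _.
by rewrite !mxE; exact: Fn.
Qed.

(** An entrywise l^1 norm; it bounds the entries of matrix powers geometrically, as [ler_mulmx_exp]
    shows. *)
Definition mx_abs_sum A : R := \sum_i \sum_j `|A i j|.

Lemma mx_abs_sum_ge0 A : 0 <= mx_abs_sum A.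
Proof. by apply: sumr_ge0 => i _; apply: sumr_ge0. Qed.

Lemma ler_row_mx_abs_sum A i : \sum_j `|A i j| <= mx_abs_sum A.
Proof.
by rewrite [leRHS](bigD1 i)//= lerDl; apply: sumr_ge0 => k _; apply: sumr_ge0.
Qed.

Lemma ler_mulmx_exp A M k i j : `|(M *m A ^+ k) i j| <= mx_abs_sum M * mx_abs_sum A ^+ k.
Proof.
elim: k i j => [|k IH] i j.
  rewrite expr0 mulr1 mulmxE mulr1.
  by apply: le_trans (ler_row_mx_abs_sum M i); rewrite [leRHS](bigD1 j)//= lerDl sumr_ge0.
rewrite exprSr -mulmxE mulmxA mxE exprSr mulrA (le_trans (ler_norm_sum _ _ _))//.
apply: (@le_trans _ _ (\sum_l (mx_abs_sum M * mx_abs_sum A ^+ k) * `|A l j|)).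
  by apply: ler_sum => l _; rewrite normrM ler_wpM2r.
rewrite -mulr_sumr ler_wpM2l ?mulr_ge0 ?exprn_ge0 ?mx_abs_sum_ge0//.
by apply: ler_sum => l _; rewrite [leRHS](bigD1 j)//= lerDl sumr_ge0.
Qed.

(** Coefficients of the scalar power series for the (i, j) entry of M e^{At}. The left factor M
    closes the family under termwise differentiation, which replaces M by M A. *)
Definition exp_entry A M (i j : 'I_p) (k : nat) : R := (M *m A ^+ k) i j / k`!%:R.

Lemma is_cvg_exp_entry A M i j t : cvgn (pseries (exp_entry A M i j) t).
Proof.
apply: normed_cvg; apply: (@series_le_cvg _ _
  (fun k => mx_abs_sum M * exp_coeff (mx_abs_sum A * `|t|) k)) => [n|n|n|].
- exact: normr_ge0.
- by rewrite /exp_coeff/= !mulr_ge0 ?mx_abs_sum_ge0 ?exprn_ge0 ?mulr_ge0 ?mx_abs_sum_ge0 ?invr_ge0.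
- rewrite /exp_coeff/= /exp_entry !normrM normfV normr_nat normrX exprMn.
  rewrite [leRHS](_ : _ = mx_abs_sum M * mx_abs_sum A ^+ n / n`!%:R * `|t| ^+ n); last by ring.
  by rewrite !ler_wpM2r ?invr_ge0 ?exprn_ge0// ler_mulmx_exp.
- have /= := @is_cvg_seriesZ _ _ (mx_abs_sum M) (is_cvg_series_exp_coeff (mx_abs_sum A * `|t|)).
  by [].
Qed.

Lemma pseries_diffs_exp_entry A M i j :
  pseries_diffs (exp_entry A M i j) = exp_entry A (M *m A) i j.
Proof.
apply/funext => k; rewrite /pseries_diffs /exp_entry factS natrM invfM.
by rewrite exprS -mulmxE mulmxA mulrCA [_ * (_ / _)]mulrA divff ?pnatr_eq0// mul1r.
Qed.

(** Defined entry by entry, so that differentiation of scalar power series applies; [expmxE]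
    identifies it with the matrix series. *)
Definition mxexp A t : 'M[R]_p := \matrix_(i, j) limn (pseries (exp_entry A 1%:M i j) t).

Lemma lim_exp_entry A M i j t :
  limn (pseries (exp_entry A M i j) t) = (M *m mxexp A t) i j.
Proof.
apply/cvg_lim => //; rewrite mxE.
have -> : pseries (exp_entry A M i j) t =
    (fun n => \sum_k M i k * pseries (exp_entry A 1%:M k j) t n).
  apply/funext => n; rewrite /pseries/series/=.
  under [RHS]eq_bigr do rewrite mulr_sumr.
  rewrite exchange_big/=; apply: eq_bigr => m _.
  rewrite /exp_entry mxE !mulr_suml; apply: eq_bigr => k _; rewrite mul1mx; ring.
apply: cvg_sumr => k; apply: cvgMr; rewrite mxE; exact: is_cvg_exp_entry.
Qed.

Lemma mxexp_comm A t : mxexp A t *m A = A *m mxexp A t.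
Proof.
apply/matrixP => i j; rewrite -lim_exp_entry; apply/esym/cvg_lim => //; rewrite mxE.
have -> : pseries (exp_entry A A i j) t =
    (fun n => \sum_k pseries (exp_entry A 1%:M i k) t n * A k j).
  apply/funext => n; rewrite /pseries/series/=.
  under [RHS]eq_bigr do rewrite mulr_suml.
  rewrite exchange_big/=; apply: eq_bigr => m _.
  rewrite /exp_entry mulmxE -exprS exprSr -mulmxE mxE !mulr_suml.
  by apply: eq_bigr => k _; rewrite mul1mx; ring.
apply: cvg_sumr => k; apply: cvgMl; rewrite mxE; exact: is_cvg_exp_entry.
Qed.

Lemma expmxE A t : expmx (t *: A) = mxexp A t.
Proof.
apply/cvg_lim; first exact: norm_hausdorff.
apply: mx_cvg => i j; rewrite mxE.
rewrite (_ : (fun n => _) = pseries (exp_entry A 1%:M i j) t); first exact: is_cvg_exp_entry.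
apply/funext => n; rewrite /pseries/series/= summxE; apply: eq_bigr => k _.
by rewrite exprZn !mxE /exp_entry mul1mx; ring.
Qed.

Lemma is_derive_mxexp A t i j :
  is_derive t 1 (fun s => mxexp A s i j) ((A *m mxexp A t) i j).
Proof.
rewrite -lim_exp_entry.
have -> : (fun s => mxexp A s i j) = (fun s => limn (pseries (exp_entry A 1%:M i j) s)).
  by apply/funext => s; rewrite mxE.
have -> : exp_entry A A i j = pseries_diffs (exp_entry A 1%:M i j).
  by rewrite pseries_diffs_exp_entry mul1mx.
(* The series converge everywhere, so any radius beyond |t| will do. *)
apply: (@pseries_snd_diffs _ _ (`|t| + 1)).
- exact: is_cvg_exp_entry.
- rewrite pseries_diffs_exp_entry; exact: is_cvg_exp_entry.
- rewrite !pseries_diffs_exp_entry; exact: is_cvg_exp_entry.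
- by rewrite [ltRHS]ger0_norm ?ltrDl// addr_ge0.
Qed.

Lemma mxexp0 A : mxexp A 0 = 1%:M.
Proof.
apply/matrixP => i j; rewrite mxE; apply/cvg_lim => //.
rewrite -cvg_shiftS.
rewrite (_ : (fun n => _) = cst ((1%:M : 'M[R]_p) i j)); first exact: cvg_cst.
apply/funext => n; rewrite /pseries/series/= big_nat_recl//= big1 => [|k _].
  by rewrite addr0 /exp_entry !expr0 mulr1 fact0 divr1 mulmxE mulr1.
by rewrite expr0n mulr0.
Qed.

(** The function u |-> e^{A(s+t-u)} e^{Au} has zero derivative, since A commutes with its
    exponential; its values at u = t and u = 0 are compared. *)
Lemma mxexpD A s t : mxexp A (s + t) = mxexp A s *m mxexp A t.
Proof.
apply/matrixP => i j; rewrite [RHS]mxE.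
pose f (u : R) : R := \sum_k mxexp A (s + t - u) i k * mxexp A u k j.
have df (u : R) : is_derive u 1 f 0.
  rewrite (_ : f = \sum_k ((fun v => mxexp A (s + t - v) i k) * (fun v => mxexp A v k j))); last first.
    by apply/funext => v; rewrite /f fct_sumE.
  rewrite (_ : 0 = \sum_k (mxexp A (s + t - u) i k * (A *m mxexp A u) k j -
      mxexp A u k j * (A *m mxexp A (s + t - u)) i k)).
    apply: is_derive_sum => k.
    have h1 := is_derive_mxexp A u k j.
    have h2 : is_derive u 1 (fun v => mxexp A (s + t - v) i k) (- (A *m mxexp A (s + t - u)) i k).
      have h3 := is_derive_mxexp A (s + t - u) i k.
      have h4 : is_derive u 1 (fun v : R => s + t - v) (- 1).
        rewrite (_ : (fun v => _) = cst (s + t) - id)//.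
        by apply: is_derive_eq; rewrite ?(sub0r, add0r).
      have := @is_derive1_comp _ (fun w : R => mxexp A w i k) (fun v : R => s + t - v) _ _ _ h3 h4.
      by rewrite mulrN1.
    apply: is_derive_eq; rewrite /GRing.scale/=; ring.
  rewrite sumrB.
  have -> : \sum_k mxexp A u k j * (A *m mxexp A (s + t - u)) i k =
     (A *m mxexp A (s + t - u) *m mxexp A u) i j.
    by rewrite mxE; apply: eq_bigr => k _; rewrite mulrC.
  have -> : \sum_k mxexp A (s + t - u) i k * (A *m mxexp A u) k j =
     (mxexp A (s + t - u) *m (A *m mxexp A u)) i j by rewrite [RHS]mxE.
  by rewrite mulmxA mxexp_comm subrr.
have := is_derive_0_is_cst t 0 df.
rewrite /f addrK subr0 => ->.
have -> : \sum_k mxexp A (s + t) i k * mxexp A 0 k j = (mxexp A (s + t) *m mxexp A 0) i j.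
  by rewrite mxE.
by rewrite mxexp0 mulmx1.
Qed.

Lemma mxexp_natmul A h n : mxexp A (n%:R * h) = mxexp A h ^+ n.
Proof.
elim: n => [|n IH]; first by rewrite mul0r mxexp0.
by rewrite -natr1 mulrDl mul1r mxexpD IH exprSr.
Qed.

Lemma cvg_is_derive0 (f : R -> R) (df : R) (h : R^nat) :
  is_derive (0 : R) 1 f df -> (forall n, h n != 0) -> h n @[n --> \oo] --> 0 ->
  (f (h n) - f 0) / h n @[n --> \oo] --> df.
Proof.
move=> [d <-] h0 hcvg.
have hd : h @ \oo --> (0 : R)^'.
  by move=> X X0; have [m _ mP] := hcvg _ X0; exists m => // n mn; exact: mP n mn (h0 n).
have := cvg_comp _ _ hd d; apply: cvg_trans.
apply: near_eq_cvg; near=> n.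
by rewrite /= addr0 mulrC /GRing.scale/= mulr1.
Unshelve. all: end_near. Qed.

Lemma cvg_mxexp_diffquot A (h : R^nat) i j : (forall n, h n != 0) -> h n @[n --> \oo] --> 0 ->
  (mxexp A (h n) i j - (1%:M : 'M[R]_p) i j) / h n @[n --> \oo] --> A i j.
Proof.
move=> h0 hcvg; have := is_derive_mxexp A 0 i j; rewrite mxexp0 mulmx1 => dE.
by have := cvg_is_derive0 dE h0 hcvg; rewrite mxexp0.
Qed.

End matrix_exponential.

(** * Decay of forced scalar linear equations *)

Section exponential_decay.
Variable R : realType.

(* Gronwall: [expR (c * t) * (N t - e / c)] is nonincreasing wherever the forcing is below [e]. *)
Lemma forced_decay (N dN eps : R -> R) (c : R) : 0 < c ->
  (forall t, 0 <= N t) -> (forall t : R, is_derive t 1 N (dN t)) ->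
  (forall t, dN t <= - c * N t + eps t) -> eps t @[t --> +oo] --> 0 ->
  N t @[t --> +oo] --> 0.
Proof.
move=> c0 N0 dNE dNle epscvg; apply/cvgrPdist_le => e e0.
have ec0 : 0 < e * c / 2 by rewrite divr_gt0// mulr_gt0.
have [T [_ TP]] : \forall T \near +oo, forall t, T < t -> eps t <= e * c / 2.
  have /cvgrPdist_le/(_ _ ec0) [T [Tr TP]] := epscvg.
  exists T; split => // s Ts t st; have := TP t (lt_trans Ts st).
  by rewrite sub0r normrN => /(le_trans (ler_norm _)).
pose T1 := T + 1.
have TT1 : T < T1 by rewrite ltrDl.
pose F t := expR (c * t) * (N t - e / 2).
have dF (t : R) : is_derive t 1 F (expR (c * t) * (c * (N t - e / 2) + dN t)).
  have h := dNE t.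
  by apply: is_derive_eq; rewrite /GRing.scale/=; ring.
have Fle t : T1 <= t -> F t <= F T1.
  move=> T1t; apply: (@ler0_derive1_nincr _ F T1 t) => // x.
  - rewrite in_itv/= => /andP[Tx xt]; rewrite derive1E; have [_ ->] := dF x.
    rewrite mulr_ge0_le0 ?expR_ge0//.
    have := TP T1 TT1 x Tx; have := dNle x; lra.
  - by apply: derivable_within_continuous => y _; have [] := dF y.
have : \forall t \near +oo, T1 <= t /\ expR (- (c * t)) * `|F T1| <= e / 2.
  near=> t; split; first by near: t; exact: nbhs_pinfty_ge (num_real _).
  near: t.
  have h : expR (- (c * t)) * `|F T1| @[t --> +oo] --> 0.
    rewrite -(mul0r `|F T1|); apply: cvgMl.
    apply: (@cvg_comp _ _ _ ( *%R c) (fun x => expR (- x)) _ +oo); last exact: cvgr_expR.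
    apply/cvgryPge => A; near=> t; rewrite mulrC -ler_pdivrMr//; near: t; exact: nbhs_pinfty_ge (num_real _).
  have e20 : 0 < e / 2 by rewrite divr_gt0.
  have /cvgrPdist_le/(_ _ e20) := h.
  by apply: filterS => t; rewrite sub0r normrN => /(le_trans (ler_norm _)).
apply: filterS => t [T1t hF].
rewrite sub0r normrN ger0_norm// -(mul1r (N t)) -expR0 -(addNr (c * t)) expRD -mulrA.
have -> : expR (c * t) * N t = F t + expR (c * t) * (e / 2) by rewrite /F; ring.
rewrite mulrDr mulrA -expRD addNr expR0 mul1r.
have : expR (- (c * t)) * F t <= e / 2.
  by apply: le_trans hF; rewrite ler_wpM2l ?expR_ge0// (le_trans (Fle _ T1t))// ler_norm.
by move=> h; rewrite [leRHS]splitr; exact: lerD.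
Unshelve. all: end_near. Qed.

(* The real form of z' = (x + iy) z + (a + ib), for the squared norm of z. *)
Lemma complex_linear_decay (x y : R) (u v a b : R -> R) : x < 0 ->
  (forall t : R, is_derive t 1 u (x * u t - y * v t + a t)) ->
  (forall t : R, is_derive t 1 v (x * v t + y * u t + b t)) ->
  a t @[t --> +oo] --> 0 -> b t @[t --> +oo] --> 0 ->
  u t @[t --> +oo] --> 0 /\ v t @[t --> +oo] --> 0.
Proof.
move=> x0 du dv a0 b0.
pose N t := u t ^+ 2 + v t ^+ 2.
have N0 t : 0 <= N t by rewrite addr_ge0 ?sqr_ge0.
have Ncvg : N t @[t --> +oo] --> 0.
  (* Completing the square trades half of the decay rate for the forcing: N' <= x N + (a^2 + b^2) /
     (-x). *)
  apply: (@forced_decay N (fun t => 2 * x * N t + 2 * (u t * a t + v t * b t))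
    (fun t => (a t ^+ 2 + b t ^+ 2) / - x) (- x)) => //.
  - by rewrite oppr_gt0.
  - move=> t; have h1 := du t; have h2 := dv t; rewrite /N.
    by apply: is_derive_eq; rewrite /GRing.scale/=; ring.
  - move=> t; rewrite opprK -subr_ge0.
    have -> : x * N t + (a t ^+ 2 + b t ^+ 2) / - x - (2 * x * N t + 2 * (u t * a t + v t * b t)) =
      ((x * u t + a t) ^+ 2 + (x * v t + b t) ^+ 2) / - x.
      by rewrite /N; field; rewrite lt_eqF.
    by rewrite divr_ge0 ?addr_ge0 ?sqr_ge0// oppr_ge0 ltW.
  - suff : (a t ^+ 2 + b t ^+ 2) / - x @[t --> +oo] --> (0 * 0 + 0 * 0) / - x.
      by rewrite !mulr0 addr0 mul0r.
    by apply: cvgMl; apply: cvgD; apply: cvgM.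
have sqr_cvg (f : R -> R) : (forall t, f t ^+ 2 <= N t) -> f t @[t --> +oo] --> 0.
  move=> fN; apply/cvgrPdist_le => e e0.
  have e20 : 0 < e ^+ 2 by rewrite exprn_gt0.
  have /cvgrPdist_le/(_ _ e20) := Ncvg; apply: filterS => t.
  rewrite sub0r normrN ger0_norm// sub0r normrN => Ne.
  by rewrite -(@ler_pXn2r _ 2) ?nnegrE ?normr_ge0 ?(ltW e0)// real_normK ?num_real// (le_trans (fN t)).
by split; apply: sqr_cvg => t; rewrite ?lerDl ?lerDr sqr_ge0.
Qed.

End exponential_decay.

(** * Decay of the exponential of a stable matrix *)

Section stable_decay.
Variables (R : realType) (p' : nat).
Local Notation p := p'.+1.
Local Notation toC := (real_complex R).
Variable A : 'M[R]_p.
Local Notation AC := (map_mx toC A).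

(** Real and imaginary parts of the entries of e^{At} G are kept apart, because differentiation is
    done over the reals while the eigenvalues are complex. *)
Definition mxexp_re (G : 'M[R[i]]_p) (i j : 'I_p) (t : R) : R :=
  \sum_k mxexp A t i k * complex.Re (G k j).
Definition mxexp_im (G : 'M[R[i]]_p) (i j : 'I_p) (t : R) : R :=
  \sum_k mxexp A t i k * complex.Im (G k j).

(** A commutes with its exponential, so differentiating e^{At} c moves A onto the constant vector
    c. *)
Lemma is_derive_mxexp_comb (c : 'I_p -> R) i (t : R) :
  is_derive t 1 (fun s : R => \sum_k mxexp A s i k * c k)
    (\sum_k mxexp A t i k * \sum_l A k l * c l).
Proof.
have -> : (fun s : R => \sum_k mxexp A s i k * c k) =
    \sum_k (fun s : R => mxexp A s i k * c k).
  by apply/funext => s; rewrite fct_sumE.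
have -> : \sum_k mxexp A t i k * (\sum_l A k l * c l) = \sum_l (A *m mxexp A t) i l * c l.
  under eq_bigr do rewrite mulr_sumr.
  rewrite exchange_big/=; apply: eq_bigr => l _.
  rewrite -mxexp_comm mxE mulr_suml; apply: eq_bigr => k _; ring.
apply: is_derive_sum => k; have h := is_derive_mxexp A t i k.
by apply: is_derive_eq; rewrite /GRing.scale/=; ring.
Qed.

Lemma complexReM (z w : R[i]) : complex.Re (z * w) =
  complex.Re z * complex.Re w - complex.Im z * complex.Im w.
Proof. by case: z w => [a b] [c d]. Qed.

Lemma complexImM (z w : R[i]) : complex.Im (z * w) =
  complex.Re z * complex.Im w + complex.Im z * complex.Re w.
Proof. by case: z w => [a b] [c d]. Qed.

Lemma complexReD (z w : R[i]) : complex.Re (z + w) = complex.Re z + complex.Re w.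
Proof. by case: z w => [a b] [c d]. Qed.

Lemma complexImD (z w : R[i]) : complex.Im (z + w) = complex.Im z + complex.Im w.
Proof. by case: z w => [a b] [c d]. Qed.

Lemma Re_mulmx_real (G : 'M[R[i]]_p) i j :
  complex.Re ((AC *m G) i j) = \sum_l A i l * complex.Re (G l j).
Proof.
rewrite mxE raddf_sum; apply: eq_bigr => l _.
by apply: (eq_trans (complexReM _ _)); rewrite mxE/= mul0r subr0.
Qed.

Lemma Im_mulmx_real (G : 'M[R[i]]_p) i j :
  complex.Im ((AC *m G) i j) = \sum_l A i l * complex.Im (G l j).
Proof.
rewrite mxE raddf_sum; apply: eq_bigr => l _.
by apply: (eq_trans (complexImM _ _)); rewrite mxE/= mul0r addr0.
Qed.

(* Cayley-Hamilton provides a split annihilating polynomial; removing its linear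
   factors one at a time leaves a scalar forced equation at each step. *)
Lemma mxexp_decay_annihilated (s : seq R[i]) (G : 'M[R[i]]_p) :
  (forall z, z \in s -> complex.Re z < 0) ->
  horner_mx AC (\prod_(z <- s) ('X - z%:P)) * G = 0 ->
  forall i j, mxexp_re G i j t @[t --> +oo] --> 0 /\
              mxexp_im G i j t @[t --> +oo] --> 0.
Proof.
elim: s G => [|z s IH] G sRe; rewrite ?big_nil ?big_cons.
  rewrite rmorph1 mul1r => -> i j; rewrite /mxexp_re /mxexp_im.
  split.
    rewrite (_ : (fun _ => _) = cst 0); first exact: cvg_cst.
    apply/funext => t; rewrite big1// => k _.
    have -> : complex.Re ((0 : 'M[R[i]]_p) k j) = 0 by rewrite mxE.
    by rewrite mulr0.
  rewrite (_ : (fun _ => _) = cst 0); first exact: cvg_cst.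
  apply/funext => t; rewrite big1// => k _.
  have -> : complex.Im ((0 : 'M[R[i]]_p) k j) = 0 by rewrite mxE.
  by rewrite mulr0.
move=> sG i j.
(* With y = e^{At} G, one has y' = z y + e^{At} G', and G' is annihilated by the remaining
   factors. *)
pose G' := AC *m G - z *: G.
have {}IH : forall i j, mxexp_re G' i j t @[t --> +oo] --> 0 /\
              mxexp_im G' i j t @[t --> +oo] --> 0.
  apply: IH => [w ws|]; first by apply: sRe; rewrite inE ws orbT.
  rewrite -sG mulrC rmorphM -mulrA; congr (_ * _).
  by rewrite rmorphB/= horner_mx_X horner_mx_C mulrBl -!mulmxE mul_scalar_mx.
have GE : AC *m G = z *: G + G' by rewrite /G' addrC subrK.
move: G' IH GE => G' IH GE.
have [re0 im0] := IH i j.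
have zRe : complex.Re z < 0 by apply: sRe; rewrite inE eqxx.
have du (t : R) : is_derive t 1 (mxexp_re G i j)
    (complex.Re z * mxexp_re G i j t - complex.Im z * mxexp_im G i j t + mxexp_re G' i j t).
  have := is_derive_mxexp_comb (fun k => complex.Re (G k j)) i t.
  congr (is_derive _ _ _ _).
  rewrite /mxexp_re /mxexp_im !mulr_sumr -sumrB -big_split; apply: eq_bigr => k _ /=.
  have -> : \sum_l A k l * complex.Re (G l j) =
      complex.Re z * complex.Re (G k j) - complex.Im z * complex.Im (G k j) + complex.Re (G' k j).
    by rewrite -Re_mulmx_real GE !mxE complexReD complexReM.
  by ring.
have dv (t : R) : is_derive t 1 (mxexp_im G i j)
    (complex.Re z * mxexp_im G i j t + complex.Im z * mxexp_re G i j t + mxexp_im G' i j t).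
  have := is_derive_mxexp_comb (fun k => complex.Im (G k j)) i t.
  congr (is_derive _ _ _ _).
  rewrite /mxexp_re /mxexp_im !mulr_sumr -!big_split; apply: eq_bigr => k _ /=.
  have -> : \sum_l A k l * complex.Im (G l j) =
      complex.Re z * complex.Im (G k j) + complex.Im z * complex.Re (G k j) + complex.Im (G' k j).
    by rewrite -Im_mulmx_real GE !mxE complexImD complexImM.
  by ring.
exact: (complex_linear_decay zRe du dv re0 im0).
Qed.

(** Take G = 1 and the roots of the characteristic polynomial, which are the eigenvalues. *)
Lemma cvg_mxexp_stable i j :
  (forall z : R[i], eigenvalue AC z -> complex.Re z < 0) ->
  mxexp A t i j @[t --> +oo] --> 0.
Proof.
move=> stab.
have [s sE] := closed_field_poly_normal (char_poly AC).
rewrite (monicP (char_poly_monic _)) scale1r in sE.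
have [|//|] := @mxexp_decay_annihilated s 1 _ _ i j.
- move=> z zs; apply: stab; rewrite eigenvalue_root_char sE.
  by rewrite root_prod_XsubC.
- by rewrite mulr1 -sE Cayley_Hamilton.
move=> h _; move: h; apply: cvg_trans; apply: near_eq_cvg; near=> t.
rewrite /mxexp_re -[1]/(1%:M) (bigD1 j)//= [1%:M j j]mxE eqxx/= mulr1 big1 ?addr0// => k kj.
by rewrite [1%:M k j]mxE (negbTE kj) mulr0.
Unshelve. all: end_near. Qed.

End stable_decay.

(** * Fourier transforms of Riemann sums *)

Section complex_sequences.
Variable R : realType.
Implicit Types (u v : nat -> R[i]) (l k : R[i]).

(** Convergence by real and imaginary parts, so that complex limits feed directly into real limit
    theorems. *)
Definition cvgC u l : Prop :=
  complex.Re (u n) @[n --> \oo] --> complex.Re l /\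
  complex.Im (u n) @[n --> \oo] --> complex.Im l.

Lemma cvgC_cst l : cvgC (fun=> l) l.
Proof. by split; exact: cvg_cst. Qed.

Lemma cvgCD u v l k : cvgC u l -> cvgC v k -> cvgC (fun n => u n + v n) (l + k).
Proof.
move=> [u1 u2] [v1 v2]; split.
  by rewrite complexReD; under eq_fun do rewrite complexReD; exact: cvgD.
by rewrite complexImD; under eq_fun do rewrite complexImD; exact: cvgD.
Qed.

Lemma cvgCN u l : cvgC u l -> cvgC (fun n => - u n) (- l).
Proof.
have reN (z : R[i]) : complex.Re (- z) = - complex.Re z by case: z.
have imN (z : R[i]) : complex.Im (- z) = - complex.Im z by case: z.
move=> [u1 u2]; split.
  by rewrite reN; under eq_fun do rewrite reN; exact: cvgN.
by rewrite imN; under eq_fun do rewrite imN; exact: cvgN.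
Qed.

Lemma cvgCM u v l k : cvgC u l -> cvgC v k -> cvgC (fun n => u n * v n) (l * k).
Proof.
move=> [u1 u2] [v1 v2]; split.
  by rewrite complexReM; under eq_fun do rewrite complexReM; apply: cvgB; apply: cvgM.
by rewrite complexImM; under eq_fun do rewrite complexImM; apply: cvgD; apply: cvgM.
Qed.

Lemma cvgC_sum (I : Type) (r : seq I) (F : I -> nat -> R[i]) (L : I -> R[i]) :
  (forall i, cvgC (F i) (L i)) ->
  cvgC (fun n => \sum_(i <- r) F i n) (\sum_(i <- r) L i).
Proof.
move=> FL; elim: r => [|i r IH].
  by rewrite big_nil; under [X in cvgC X]funext do rewrite big_nil; exact: cvgC_cst.
rewrite big_cons; under [X in cvgC X]funext do rewrite big_cons; exact: cvgCD.
Qed.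

Lemma cvgC_prod (I : Type) (r : seq I) (F : I -> nat -> R[i]) (L : I -> R[i]) :
  (forall i, cvgC (F i) (L i)) ->
  cvgC (fun n => \prod_(i <- r) F i n) (\prod_(i <- r) L i).
Proof.
move=> FL; elim: r => [|i r IH].
  by rewrite big_nil; under [X in cvgC X]funext do rewrite big_nil; exact: cvgC_cst.
rewrite big_cons; under [X in cvgC X]funext do rewrite big_cons; exact: cvgCM.
Qed.

Lemma cvgC_eq u v l : (\forall n \near \oo, u n = v n) -> cvgC u l -> cvgC v l.
Proof.
move=> uv [h1 h2]; split.
  by apply: cvg_trans h1; apply: near_eq_cvg; near=> n; rewrite (near uv n).
by apply: cvg_trans h2; apply: near_eq_cvg; near=> n; rewrite (near uv n).
Unshelve. all: end_near. Qed.

(** A real-valued squared modulus, polynomial in the two parts; the norm of [R[i]] takes its values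
    in [R[i]]. *)
Definition sqnormC (z : R[i]) : R := complex.Re z ^+ 2 + complex.Im z ^+ 2.

Lemma sqnormC_eq0 z : (sqnormC z == 0) = (z == 0).
Proof.
case: z => a b; rewrite /sqnormC/= paddr_eq0 ?sqr_ge0// !sqrf_eq0.
by rewrite eq_complex.
Qed.

Lemma sqnormC_ge0 z : 0 <= sqnormC z.
Proof. by rewrite addr_ge0 ?sqr_ge0. Qed.

Lemma sqnormCM z w : sqnormC (z * w) = sqnormC z * sqnormC w.
Proof. by rewrite /sqnormC complexReM complexImM; ring. Qed.

Lemma invC_sqnorm (z : R[i]) :
  z^-1 = (complex.Re z / sqnormC z +i* (- complex.Im z / sqnormC z))%C.
Proof.
case: z => a b; rewrite /sqnormC/=.
by rewrite mulNr.
Qed.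

Lemma cvgC_sqnorm u l : cvgC u l -> sqnormC (u n) @[n --> \oo] --> sqnormC l.
Proof. by move=> [h1 h2]; apply: cvgD; rewrite expr2; apply: cvgM. Qed.

Lemma cvgCV u l : l != 0 -> cvgC u l -> cvgC (fun n => (u n)^-1) l^-1.
Proof.
move=> l0 ul; have nl : sqnormC l != 0 by rewrite sqnormC_eq0.
have nu := cvgC_sqnorm ul; case: ul => h1 h2; split.
  rewrite invC_sqnorm/=; under eq_fun do rewrite invC_sqnorm/=.
  by apply: cvgM => //; apply: cvgV.
rewrite invC_sqnorm/=; under eq_fun do rewrite invC_sqnorm/=.
by apply: cvgM; [apply: cvgN|apply: cvgV].
Qed.

Lemma cvgC_neq0 u l : l != 0 -> cvgC u l -> \forall n \near \oo, u n != 0.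
Proof.
move=> l0 /cvgC_sqnorm nu; have nl : 0 < sqnormC l by rewrite lt_neqAle eq_sym sqnormC_eq0 l0 sqnormC_ge0.
have /cvgr_gt/(_ _ nl) := nu.
by apply: filterS => n; rewrite -sqnormC_eq0 => /gt_eqF ->.
Qed.

(** Meant for the phases e^{-iwmh}, which stay bounded but need not converge. *)
Lemma cvgC_bounded0 u v : (forall n, sqnormC (u n) <= 1) -> cvgC v 0 ->
  cvgC (fun n => u n * v n) 0.
Proof.
move=> u1 v0.
have h : sqnormC (u n * v n) @[n --> \oo] --> 0.
  apply: (@squeeze_cvgr _ _ _ _ (cst 0) (fun n => sqnormC (v n))).
  - near=> n; rewrite sqnormC_ge0/= sqnormCM ler_piMl ?sqnormC_ge0//.
  - exact: cvg_cst.
  - by have := cvgC_sqnorm v0; rewrite /sqnormC/= expr0n addr0.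
have key (f : nat -> R) : (forall n, f n ^+ 2 <= sqnormC (u n * v n)) -> f n @[n --> \oo] --> 0.
  move=> fN; apply/cvgrPdist_le => e e0.
  have e20 : 0 < e ^+ 2 by rewrite exprn_gt0.
  have /cvgrPdist_le/(_ _ e20) := h; apply: filterS => t.
  rewrite sub0r normrN ger0_norm ?sqnormC_ge0// sub0r normrN => Ne.
  by rewrite -(@ler_pXn2r _ 2) ?nnegrE ?normr_ge0 ?(ltW e0)// real_normK ?num_real// (le_trans (fN t)).
by split; apply: key => n; rewrite ?lerDl ?lerDr sqr_ge0.
Unshelve. all: end_near. Qed.

Lemma cvgC_real (f : nat -> R) (l : R) :
  f n @[n --> \oo] --> l -> cvgC (fun n => (f n)%:C%C) l%:C%C.
Proof. by move=> fl; split => //=; exact: cvg_cst. Qed.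

End complex_sequences.

Section complex_matrices.
Variables (R : realType) (n : nat).

Definition mxcvgC (m k : nat) (F : nat -> 'M[R[i]]_(m, k)) (L : 'M[R[i]]_(m, k)) :=
  forall i j, cvgC (fun N => F N i j) (L i j).

Lemma mxcvgCM (m k l : nat) (F : nat -> 'M[R[i]]_(m, k)) (G : nat -> 'M[R[i]]_(k, l)) L K :
  mxcvgC F L -> mxcvgC G K -> mxcvgC (fun N => F N *m G N) (L *m K).
Proof.
move=> FL GK i j; rewrite mxE; under [X in cvgC X]funext do rewrite mxE.
by apply: cvgC_sum => s; apply: cvgCM.
Qed.

Lemma mxcvgCD (m k : nat) (F G : nat -> 'M[R[i]]_(m, k)) L K :
  mxcvgC F L -> mxcvgC G K -> mxcvgC (fun N => F N + G N) (L + K).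
Proof.
move=> FL GK i j; rewrite mxE; under [X in cvgC X]funext do rewrite mxE.
exact: cvgCD.
Qed.

Lemma mxcvgCZ (m k : nat) (c : nat -> R[i]) (F : nat -> 'M[R[i]]_(m, k)) d L :
  cvgC c d -> mxcvgC F L -> mxcvgC (fun N => c N *: F N) (d *: L).
Proof.
move=> cd FL i j; rewrite mxE; under [X in cvgC X]funext do rewrite mxE.
exact: cvgCM.
Qed.

Lemma mxcvgC_cst (m k : nat) (L : 'M[R[i]]_(m, k)) : mxcvgC (fun=> L) L.
Proof. by move=> i j; exact: cvgC_cst. Qed.

Lemma cvgC_det (k : nat) (F : nat -> 'M[R[i]]_k) (L : 'M[R[i]]_k) :
  mxcvgC F L -> cvgC (fun N => \det (F N)) (\det L).
Proof.
move=> FL; rewrite /determinant.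
apply: cvgC_sum => s; apply: cvgCM; first exact: cvgC_cst.
by apply: cvgC_prod => i.
Qed.

Lemma mxcvgC_adj (k : nat) (F : nat -> 'M[R[i]]_k) (L : 'M[R[i]]_k) :
  mxcvgC F L -> mxcvgC (fun N => \adj (F N)) (\adj L).
Proof.
move=> FL i j; rewrite !mxE; under [X in cvgC X]funext do rewrite mxE.
apply: cvgCM; first exact: cvgC_cst.
apply: cvgC_det => a b; rewrite !mxE; under [X in cvgC X]funext do rewrite !mxE.
exact: FL.
Qed.

(* Cramer's rule, so that no continuity of the matrix inverse is needed *)
Lemma mxcvgC_solve (k : nat) (D : nat -> 'M[R[i]]_k) (y r : nat -> 'cV[R[i]]_k) Q x :
  \det Q != 0 -> mxcvgC D Q -> (forall N, D N *m y N = r N) -> mxcvgC r (Q *m x) ->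
  mxcvgC y x.
Proof.
move=> Q0 DQ Dy rx i j.
have h := mxcvgCM (mxcvgC_adj DQ) rx.
rewrite mulmxA mul_adj_mx mul_scalar_mx in h.
have d0 := cvgC_neq0 Q0 (cvgC_det DQ).
have := cvgCM (cvgCV Q0 (cvgC_det DQ)) (h i j).
rewrite mxE mulKf//; apply: cvgC_eq.
near=> N; rewrite -Dy mulmxA mul_adj_mx mul_scalar_mx mxE mulKf//.
by near: N.
Unshelve. all: end_near. Qed.

End complex_matrices.

Section expi_facts.
Variable R : realType.
Implicit Types a b w : R.

Lemma expiD a b : expi (a + b) = expi a * expi b.
Proof.
rewrite /expi cosD sinD; apply/eqP; rewrite eq_complex; apply/andP; split; apply/eqP.
  by rewrite complexReM.
by rewrite complexImM/=; ring.
Qed.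

Lemma expi0 : expi (0 : R) = 1.
Proof. by rewrite /expi cos0 sin0. Qed.

Lemma sqnormC_expi a : sqnormC (expi a) = 1.
Proof. by rewrite /sqnormC/= cos2Dsin2. Qed.

Lemma expiX a n : expi a ^+ n = expi (n%:R * a).
Proof.
elim: n => [|n IH]; first by rewrite mul0r expi0.
by rewrite exprS IH -expiD -natr1 mulrDl mul1r addrC.
Qed.

Lemma cvgC_expi w (h : R^nat) : h n @[n --> \oo] --> 0 ->
  cvgC (fun n => expi (w * h n)) 1.
Proof.
move=> h0; have wh : w * h n @[n --> \oo] --> 0 by rewrite -(mulr0 w); exact: cvgMr.
split => /=.
  by have := cvg_comp _ _ wh (@continuous_cos R 0); rewrite cos0.
by have := cvg_comp _ _ wh (@continuous_sin R 0); rewrite sin0.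
Qed.

Lemma cvgC_expi_diffquot w (h : R^nat) : (forall n, h n != 0) -> h n @[n --> \oo] --> 0 ->
  cvgC (fun n => (h n)^-1%:C%C * (expi (w * h n) - 1)) (0 +i* w)%C.
Proof.
move=> h0 hcvg; split => /=.
- have dE : is_derive (0 : R) 1 (fun x : R => cos (w * x)) 0.
    by apply: is_derive_eq; rewrite /GRing.scale/= mulr0 sin0 oppr0 mul0r ?mulr0.
  have := cvg_is_derive0 dE h0 hcvg; rewrite mulr0 cos0.
  by apply: cvg_trans; apply: near_eq_cvg; apply: nearW => n; ring.
- have dE : is_derive (0 : R) 1 (fun x : R => sin (w * x)) w.
    by apply: is_derive_eq; rewrite /GRing.scale/= mulr0 cos0 ?mul1r ?mulr1.
  have := cvg_is_derive0 dE h0 hcvg; rewrite mulr0 sin0.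
  by apply: cvg_trans; apply: near_eq_cvg; apply: nearW => n; ring.
Qed.

End expi_facts.

(** * Geometric sums and the resolvent at iw *)

Section riemann_transform.
Variables (R : realType) (p' : nat).
Local Notation p := p'.+1.
Local Notation toC := (real_complex R).
Variables (A : 'M[R]_p) (b : 'rV[R]_p) (d : 'cV[R]_p).
Local Notation AC := (map_mx toC A).
Hypothesis stab : forall z : R[i], eigenvalue AC z -> complex.Re z < 0.

Definition matrix_kernel (s : R) : R := (b *m mxexp A s *m d) 0 0.

(** This is e^{(A - iw)h}, the ratio of the geometric sums. *)
Definition step_mx (w h : R) : 'M[R[i]]_p := expi (- w * h) *: map_mx toC (mxexp A h).

Lemma step_mxX w h k :
  step_mx w h ^+ k = expi (- w * (k%:R * h)) *: map_mx toC (mxexp A (k%:R * h)).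
Proof.
by rewrite /step_mx exprZn expiX mxexp_natmul -rmorphXn/= mulrCA.
Qed.

Lemma matrix_kernel_step w h k :
  (matrix_kernel (k%:R * h))%:C%C * expi (- w * (k%:R * h)) =
  (map_mx toC b *m (step_mx w h ^+ k) *m map_mx toC d) 0 0.
Proof.
rewrite step_mxX -scalemxAr -scalemxAl mxE mulrC; congr (_ * _).
by rewrite -!map_mxM [RHS]mxE.
Qed.

Lemma riemann_transformE w h (m : nat) :
  (\sum_(j < m) (matrix_kernel (j.+1%:R * h))%:C%C * expi (- w * (j.+1%:R * h))) *
    (expi (w * h) - 1) =
  (map_mx toC b *m ((expi (w * h) - 1) *: ((\sum_(j < m) step_mx w h ^+ j.+1) *m map_mx toC d))) 0 0.
Proof.
rewrite -scalemxAr mxE mulrC; congr (_ * _).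
rewrite mulmxA mulmx_sumr mulmx_suml summxE; apply: eq_bigr => j _.
by rewrite matrix_kernel_step.
Qed.

(** Both 1 - e^{(A - iw)h} and e^{iwh} - 1 vanish as h tends to 0; after division by h they have the
    limits iw - A and iw. *)
Lemma geometric_step w h (m : nat) : h != 0 ->
  (h^-1%:C%C *: (1 - step_mx w h)) *m
    ((expi (w * h) - 1) *: ((\sum_(j < m) step_mx w h ^+ j.+1) *m map_mx toC d)) =
  (h^-1%:C%C * (expi (w * h) - 1)) *:
    (step_mx w h *m (1 - step_mx w h ^+ m) *m map_mx toC d).
Proof.
move=> h0; rewrite -scalemxAr -scalemxAl scalerA mulrC mulmxA; congr (_ *: (_ *m _)).
elim: m => [|m IH]; first by rewrite big_ord0 mulmx0 expr0 subrr mulmx0.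
rewrite big_ord_recr/= mulmxDr IH mulmxBr mulmxBl [in RHS]mulmxBr.
rewrite !mulmxE !mulr1 mul1r -!exprS; rewrite addrA; congr (_ - _).
by rewrite addrNK.
Qed.

Lemma mxcvgC_step w (h : R^nat) : (forall n, h n != 0) -> h n @[n --> \oo] --> 0 ->
  mxcvgC (fun n => (h n)^-1%:C%C *: (1 - step_mx w (h n))) ((0 +i* w)%C%:M - AC).
Proof.
move=> h0 hcvg.
have -> : (0 +i* w)%C%:M - AC = (- (0 +i* - w)%C) *: 1%:M + (- 1) *: AC.
  rewrite scaleN1r scalemx1; congr (_%:M - _).
  by apply/eqP; rewrite eq_complex/= oppr0 opprK !eqxx.
(* 1 - e^{-iwh} E = -(e^{-iwh} - 1) - e^{-iwh} (E - 1), which exhibits two difference quotients. *)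
have -> : (fun n => (h n)^-1%:C%C *: (1 - step_mx w (h n))) =
    (fun n => (- ((h n)^-1%:C%C * (expi (- w * h n) - 1))) *: 1%:M +
      (- expi (- w * h n)) *: ((h n)^-1%:C%C *: (map_mx toC (mxexp A (h n)) - 1%:M))).
  apply/funext => n; rewrite /step_mx [1]/(1%:M).
  apply/matrixP => i j; rewrite !mxE; ring.
apply: mxcvgCD; apply: mxcvgCZ.
- by apply: cvgCN; exact: cvgC_expi_diffquot.
- exact: mxcvgC_cst.
- by apply: cvgCN; exact: cvgC_expi.
- move=> i j; rewrite mxE; have := cvgC_real (@cvg_mxexp_diffquot _ _ A h i j h0 hcvg).
  apply: cvgC_eq; apply: nearW => n; rewrite !mxE.
  by rewrite rmorphM/= rmorphB/= mulrC; congr (_ * (_ - _)); case: (i == j).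
Qed.

Lemma mxcvgC_step1 w (h : R^nat) : (forall n, h n != 0) -> h n @[n --> \oo] --> 0 ->
  mxcvgC (fun n => step_mx w (h n)) 1%:M.
Proof.
move=> h0 hcvg; rewrite -[1%:M]scale1r; apply: mxcvgCZ; first exact: cvgC_expi.
move=> i j; rewrite mxE; under [X in cvgC X]funext do rewrite mxE.
have -> : (i == j)%:R = ((1%:M : 'M[R]_p) i j)%:C%C :> R[i] by rewrite mxE; case: (i == j).
apply: cvgC_real.
have := is_derive_mxexp A 0 i j => /is_derive1_cvg; rewrite mxexp0 => cE.
exact: cvg_comp hcvg cE.
Qed.

(** The phase has modulus 1, and the real exponential at time mh tends to 0 by stability. *)
Lemma mxcvgC_step_pow w (h : R^nat) (m : nat -> nat) :
  (m n)%:R * h n @[n --> \oo] --> +oo ->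
  mxcvgC (fun n => step_mx w (h n) ^+ m n) 0.
Proof.
move=> mh i j; rewrite mxE; under [X in cvgC X]funext do rewrite step_mxX mxE.
apply: cvgC_bounded0 => [n|]; first by rewrite sqnormC_expi.
under [X in cvgC X]funext do rewrite mxE.
by apply: cvgC_real; apply: cvg_comp mh (cvg_mxexp_stable _ _ stab).
Qed.

(** A stable matrix has no eigenvalue on the imaginary axis. *)
Lemma det_iw_neq0 w : \det ((0 +i* w)%C%:M - AC) != 0.
Proof.
apply/negP => /eqP det0.
have : eigenvalue AC (0 +i* w)%C.
  rewrite /eigenvalue /eigenspace kermx_eq0 row_free_unit unitmxE unitfE negbK.
  by rewrite -opprB -scaleN1r detZ det0 mulr0.
by move=> /stab/=; rewrite ltxx.
Qed.

(** In the limit [geometric_step] reads (iw - A) y = iw d, the last power having decayed;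
    [mxcvgC_solve] then gives y = iw x. *)
Lemma cvgC_riemann_transform w (h : R^nat) (m : nat -> nat) (x : 'cV[R[i]]_p) :
  (forall n, h n != 0) -> h n @[n --> \oo] --> 0 ->
  (m n)%:R * h n @[n --> \oo] --> +oo ->
  ((0 +i* w)%C%:M - AC) *m x = map_mx toC d ->
  cvgC (fun n => (\sum_(j < m n) (matrix_kernel (j.+1%:R * h n))%:C%C *
      expi (- w * (j.+1%:R * h n))) * (expi (w * h n) - 1))
    ((0 +i* w)%C * (map_mx toC b *m x) 0 0).
Proof.
move=> h0 hcvg mh Qx.
under [X in cvgC X]funext do rewrite riemann_transformE.
rewrite -[X in cvgC _ X](_ : (map_mx toC b *m ((0 +i* w)%C *: x)) 0 0 = _); last first.
  by rewrite -scalemxAr mxE.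
apply: (mxcvgCM (mxcvgC_cst _)).
apply: (mxcvgC_solve (det_iw_neq0 w) (mxcvgC_step w h0 hcvg)) => [N|].
  exact: geometric_step.
rewrite -scalemxAr Qx.
apply: mxcvgCZ; first exact: cvgC_expi_diffquot.
rewrite -[X in mxcvgC _ X]mul1mx -[X in mxcvgC _ (X *m _)]mulmx1.
apply: mxcvgCM; last exact: mxcvgC_cst.
apply: mxcvgCM; first exact: mxcvgC_step1.
have := mxcvgCD (mxcvgC_cst 1%:M) (mxcvgCZ (cvgC_cst (- 1)) (mxcvgC_step_pow w mh)).
by rewrite scaler0 addr0; congr (mxcvgC _ _); apply/funext => N; rewrite scaleN1r.
Qed.

End riemann_transform.

(** * Resolvent of the companion matrix *)

Section companion_resolvent.
Variables (R : realType) (p' q : nat) (alpha beta : nat -> R).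
Local Notation p := p'.+1.
Local Notation toC := (real_complex R).
Hypothesis qp : (q < p)%N.

Lemma ceval_alpha (z : R[i]) :
  ceval (alpha_poly p alpha) z = z ^+ p - \sum_(k < p) (alpha k.+1)%:C%C * z ^+ k.
Proof.
rewrite /ceval /alpha_poly rmorphB/= map_polyXn rmorph_sum hornerD hornerN hornerXn horner_sum.
congr (_ - _); apply: eq_bigr => k _.
by rewrite /= map_polyZ/= map_polyXn hornerZ hornerXn.
Qed.

Lemma ceval_beta (z : R[i]) :
  ceval (beta_poly q beta) z = \sum_(j < p) (beta_vec p q beta j 0)%:C%C * z ^+ j.
Proof.
rewrite /ceval /beta_poly rmorphD rmorph1 rmorph_sum hornerD hornerC horner_sum.
rewrite big_ord_recl !mxE/= mul1r; congr (_ + _).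
(* The hypothesis q < p allows padding with the zero entries of [beta_vec]. *)
rewrite big_add1/= big_mkord (big_ord_widen p' (fun j => (map_poly toC (beta j.+1 *: 'X^(j.+1))).[z]))//.
rewrite big_mkcond; apply: eq_bigr => j _.
rewrite !mxE/= /bump/= add1n.
case: ifPn => jq; last by rewrite mul0r.
by rewrite /= map_polyZ/= map_polyXn hornerZ hornerXn.
Qed.

(** By the shift structure every row of z - A but the last kills the vector (1, z, ..., z^(p-1));
    the last row produces alpha(z). *)
Lemma companion_powers (z : R[i]) :
  (z%:M - map_mx toC (companion p alpha)) *m (\col_(i < p) z ^+ i) =
  ceval (alpha_poly p alpha) z *: map_mx toC (delta_vec R p).
Proof.
apply/colP => i; rewrite mulmxBl mul_scalar_mx !mxE.
under eq_bigr do rewrite !mxE.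
have [ip|ip] := boolP (i.+1 == p).
  rewrite mulr1 ceval_alpha -exprS (eqP ip); congr (_ - _).
have ip' : (i.+1 < p)%N by rewrite ltn_neqAle ip ltn_ord.
rewrite mulr0 (bigD1 (Ordinal ip'))//= eqxx mul1r big1 ?addr0 -?exprS ?subrr// => j ji.
rewrite -[X in X * _]/((_ : R)%:C%C) -(inj_eq val_inj)/= in ji *.
by rewrite (negbTE ji) mul0r.
Qed.

(** A root of alpha would put the vector of powers in the kernel, and its first coordinate is 1. *)
Lemma alpha_neq0 (z : R[i]) :
  \det (z%:M - map_mx toC (companion p alpha)) != 0 -> ceval (alpha_poly p alpha) z != 0.
Proof.
move=> d0; apply/negP => /eqP a0.
have := companion_powers z; rewrite a0 scale0r => /(congr1 (mulmx (\adj (z%:M - map_mx toC (companion p alpha))))).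
rewrite mulmxA mul_adj_mx mulmx0 mul_scalar_mx => /colP/(_ 0).
by rewrite !mxE expr0 mulr1 => /eqP; rewrite (negbTE d0).
Qed.

Lemma companion_resolvent (z : R[i]) : ceval (alpha_poly p alpha) z != 0 ->
  (z%:M - map_mx toC (companion p alpha)) *m
    ((ceval (alpha_poly p alpha) z)^-1 *: (\col_(i < p) z ^+ i)) = map_mx toC (delta_vec R p).
Proof.
by move=> a0; rewrite -scalemxAr companion_powers scalerA mulVf// scale1r.
Qed.

Lemma beta_resolvent (z : R[i]) :
  (map_mx toC (beta_vec p q beta)^T *m
    ((ceval (alpha_poly p alpha) z)^-1 *: (\col_(i < p) z ^+ i))) 0 0 =
  ceval (beta_poly q beta) z / ceval (alpha_poly p alpha) z.
Proof.
rewrite -scalemxAr mxE mulrC ceval_beta; congr (_ * _).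
by rewrite mxE; apply: eq_bigr => j _; rewrite !mxE.
Qed.

End companion_resolvent.

(** * The isometry *)

Section quadratic_limits.
Variable R : realType.

(* Young's inequality in both directions, in place of the triangle inequality
   for the L^2 norms. *)
Lemma quadratic_cvg (s e : R^nat) (x : R) :
  0 <= x -> (forall n, 0 <= s n) -> (forall n, 0 <= e n) -> e n @[n --> \oo] --> 0 ->
  (forall n eta, 0 < eta -> s n <= (1 + eta) * x + (1 + eta^-1) * e n) ->
  (forall n eta, 0 < eta -> x <= (1 + eta) * s n + (1 + eta^-1) * e n) ->
  s n @[n --> \oo] --> x.
Proof.
move=> x0 s0 e0 ecvg sx xs; apply/cvgrPdist_le => eps eps0.
(* 2x + 2 bounds x, and also s n, by the upper estimate at eta = 1 once e n <= 1; each error term is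
   then at most eps / 2. *)
pose eta := eps / 2 / (2 * x + 2).
have x2 : 0 < 2 * x + 2 by rewrite ltr_wpDl// mulr_ge0.
have eta0 : 0 < eta by rewrite !divr_gt0.
have etaE : eta * (2 * x + 2) = eps / 2 by rewrite divfK// gt_eqF.
have h1 : 0 < 1 + eta^-1 by rewrite addr_gt0// invr_gt0.
have d0 : 0 < Num.min 1 (eps / 2 / (1 + eta^-1)) by rewrite lt_min ltr01 !divr_gt0.
have /cvgrPdist_le/(_ _ d0) := ecvg.
apply: filterS => n; rewrite sub0r normrN ger0_norm// le_min => /andP[en1 en2].
have en3 : (1 + eta^-1) * e n <= eps / 2 by rewrite mulrC -ler_pdivlMr.
have s1 := sx n eta eta0; have s2 := xs n eta eta0.
have s3 := sx n 1 ltr01; rewrite invr1 in s3.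
have s4 : s n <= 2 * x + 2 by lra.
have s5 : eta * s n <= eps / 2 by rewrite -etaE ler_wpM2l// ltW.
have s6 : eta * x <= eps / 2 by rewrite -etaE ler_wpM2l ?(ltW eta0)//; lra.
rewrite ler_norml; apply/andP; split; lra.
Qed.

Lemma sqrrD_young (a b eta : R) : 0 < eta ->
  (a + b) ^+ 2 <= (1 + eta) * a ^+ 2 + (1 + eta^-1) * b ^+ 2.
Proof.
move=> eta0; rewrite -subr_ge0.
have -> : (1 + eta) * a ^+ 2 + (1 + eta^-1) * b ^+ 2 - (a + b) ^+ 2 =
  (eta * a - b) ^+ 2 / eta by field; rewrite gt_eqF.
by rewrite divr_ge0 ?sqr_ge0// ltW.
Qed.

Lemma sqnormC_young (a b : R[i]) (eta : R) : 0 < eta ->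
  sqnormC (a + b) <= (1 + eta) * sqnormC a + (1 + eta^-1) * sqnormC b.
Proof.
move=> eta0; rewrite /sqnormC complexReD complexImD.
have h1 := sqrrD_young (complex.Re a) (complex.Re b) eta0.
have h2 := sqrrD_young (complex.Im a) (complex.Im b) eta0.
by rewrite (le_trans (lerD h1 h2))// le_eqVlt; apply/orP; left; apply/eqP; ring.
Qed.

Lemma sqnormCN (a : R[i]) : sqnormC (- a) = sqnormC a.
Proof. by case: a => x y; rewrite /sqnormC/= !sqrrN. Qed.

End quadratic_limits.

Section integral_facts.
Context d (T : measurableType d) (R : realType) (mu : {measure set T -> \bar R}).
Variables (D : set T) (mD : measurable D).

Lemma integral_quadratic_form (I : Type) (s : seq I) (c : I -> R)
    (F : I -> I -> T -> R) (v : I -> I -> R) :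
  (forall i j, mu.-integrable D (fun x => (F i j x)%:E)) ->
  (forall i j, \int[mu]_(x in D) (F i j x)%:E = (v i j)%:E)%E ->
  (\int[mu]_(x in D) (\sum_(i <- s) \sum_(j <- s) c i * c j * F i j x)%:E)%E =
  (\sum_(i <- s) \sum_(j <- s) c i * c j * v i j)%:E.
Proof.
move=> Fi Fv.
have intj i j : mu.-integrable D (fun x => (c i * c j)%:E * (F i j x)%:E)%E.
  exact: integrableZl.
transitivity (\int[mu]_(x in D) (\sum_(i <- s) \sum_(j <- s) (c i * c j)%:E * (F i j x)%:E))%E.
  apply: eq_integral => x _; rewrite -sumEFin; apply: eq_bigr => i _.
  by rewrite -sumEFin; apply: eq_bigr => j _.
rewrite integral_sum//=; last by move=> i; apply: integrable_sum => // j _; exact: intj.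
rewrite -sumEFin; apply: eq_bigr => i _.
rewrite -sumEFin integral_sum//=.
by apply: eq_bigr => j _; rewrite integralZl// Fv.
Qed.

Lemma integral_young (u v r : T -> R) (eta : R) : 0 < eta ->
  measurable_fun D u -> measurable_fun D v -> measurable_fun D r ->
  (forall x, D x -> 0 <= u x) -> (forall x, D x -> 0 <= v x) -> (forall x, D x -> 0 <= r x) ->
  (forall x, D x -> u x <= (1 + eta) * v x + (1 + eta^-1) * r x) ->
  (\int[mu]_(x in D) (u x)%:E <=
   (1 + eta)%:E * \int[mu]_(x in D) (v x)%:E +
   (1 + eta^-1)%:E * \int[mu]_(x in D) (r x)%:E)%E.
Proof.
move=> eta0 mu_ mv mr u0 v0 r0 uvr.
have h1 : 0 <= 1 + eta by rewrite addr_ge0// ltW.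
have h2 : 0 <= 1 + eta^-1 by rewrite addr_ge0// invr_ge0 ltW.
have scaleE (k : R) (w : T -> R) : 0 <= k -> measurable_fun D w -> (forall x, D x -> 0 <= w x) ->
    (k%:E * \int[mu]_(x in D) (w x)%:E = \int[mu]_(x in D) (k * w x)%:E)%E.
  move=> k0 mw w0; apply/esym.
  apply: (@ge0_integralZl _ _ _ mu D mD (EFin \o w) _ k%:E) => //.
    exact/measurable_EFinP.
rewrite !scaleE//.
rewrite -ge0_integralD//.
- apply: ge0_le_integral => //.
  + exact/measurable_EFinP.
  + by apply/measurable_EFinP; apply: measurable_funD; apply: measurable_funM.
- by move=> x Dx; rewrite lee_fin mulr_ge0 ?v0.
- by apply/measurable_EFinP; apply: measurable_funM.
- by move=> x Dx; rewrite lee_fin mulr_ge0 ?r0.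
- by apply/measurable_EFinP; apply: measurable_funM.
Qed.

Lemma integral_young_le (u v r : T -> R) (eta c : R) : 0 < eta ->
  measurable_fun D u -> measurable_fun D v -> measurable_fun D r ->
  (forall x, D x -> 0 <= u x) -> (forall x, D x -> 0 <= v x) -> (forall x, D x -> 0 <= r x) ->
  (forall x, D x -> u x <= (1 + eta) * v x + (1 + eta^-1) * r x) ->
  (\int[mu]_(x in D) (r x)%:E <= c%:E)%E ->
  (\int[mu]_(x in D) (u x)%:E <=
   (1 + eta)%:E * \int[mu]_(x in D) (v x)%:E + ((1 + eta^-1) * c)%:E)%E.
Proof.
move=> eta0 mu_ mv mr u0 v0 r0 uvr rc.
apply: (le_trans (integral_young eta0 mu_ mv mr u0 v0 r0 uvr)).
apply: leeD => //; rewrite EFinM; apply: lee_pmul => //.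
- by rewrite lee_fin addr_ge0// invr_ge0 ltW.
- by apply: integral_ge0 => x Dx; rewrite lee_fin r0.
Qed.

(** Fatou's lemma for pointwise convergent real functions whose integrals have convergent bounds; it
    also yields that the limit has a finite integral. *)
Lemma fatou_bound (g : nat -> T -> R) (f : T -> R) (c : R^nat) (l : R) :
  (forall n, measurable_fun D (g n)) -> (forall n x, D x -> 0 <= g n x) ->
  (forall x, D x -> g n x @[n --> \oo] --> f x) ->
  (forall n, \int[mu]_(x in D) (g n x)%:E <= (c n)%:E)%E ->
  c n @[n --> \oo] --> l ->
  (\int[mu]_(x in D) (f x)%:E <= l%:E)%E.
Proof.
move=> mg g0 gf gc cl.
have := @fatou _ _ _ mu D mD (fun n x => (g n x)%:E) (fun n => (measurable_EFinP _ _).2 (mg n)).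
have g0' n x : D x -> (0 <= (g n x)%:E)%E by move=> /g0; rewrite lee_fin.
move=> /(_ g0').
have -> : (\int[mu]_(x in D) limn_einf ((fun n x => (g n x)%:E)^~ x) = \int[mu]_(x in D) (f x)%:E)%E.
  apply: eq_integral => x /set_mem Dx.
  have : ((g n x)%:E @[n --> \oo] --> (f x)%:E)%E by apply: cvg_EFin; [exact: nearW|exact: gf].
  by move=> /cvg_limn_einf_sup[->].
move=> /le_trans; apply.
have : ((c n)%:E @[n --> \oo] --> l%:E)%E by apply: cvg_EFin; [exact: nearW|].
move=> /cvg_limn_einf_sup[<- _].
rewrite !limn_einf_lim; apply: lee_lim.
- exact: is_cvg_einfs.
- exact: is_cvg_einfs.
- apply: nearW => n; apply: le_ereal_inf_tmp => _ [m nm <-].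
  by apply: (le_trans _ (gc m)); apply: ereal_inf_lbound; exists m.
Qed.

End integral_facts.

(** * Step sums of fractional Brownian motion and their Fourier images *)

Section spectral_isometry.
Context d (T : measurableType d) (R : realType) (P : probability T R).
Variables (H : R) (B : R -> {RV P >-> R}).
Hypotheses (H01 : 0 < H < 1) (hB : is_fBm H B).
Local Notation mu := (@lebesgue_measure R).
Local Notation pos := (`]0%R, +oo[%classic : set R).

Let mpos : measurable pos. Proof. exact: measurable_itv. Qed.

Definition fbm_cov (t s : R) : R :=
  2^-1 * (`|t| `^ (2 * H) + `|s| `^ (2 * H) - `|t - s| `^ (2 * H)).

(* A list of pairs (c, t) stands for the linear combination of the c B_t, and is
   mapped to the combination of the c (e^{itw} - 1). *)
Definition step_rv (l : seq (R * R)) (x : T) : R := \sum_(z <- l) z.1 * B z.2 x.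

Definition step_fourier (l : seq (R * R)) (w : R) : R[i] :=
  \sum_(z <- l) z.1%:C%C * (expi (z.2 * w) - 1).

Definition step_var (l : seq (R * R)) : R :=
  \sum_(y <- l) \sum_(z <- l) y.1 * z.1 * fbm_cov y.2 z.2.

(** Second moments are finite by the covariance at equal times, and |ab| <= a^2 + b^2. *)
Lemma integrable_fbmM t s : P.-integrable setT (fun x => (B t x * B s x)%:E).
Proof.
have sq (r : R) : P.-integrable setT (fun x => (B r x * B r x)%:E).
  apply/integrableP; split.
    by apply/measurable_EFinP; apply: measurable_funM.
  have [_ _ _ /(_ r r)] := hB; rewrite unlock => E.
  under eq_integral => x _ do rewrite gee0_abs ?lee_fin -?expr2 ?sqr_ge0//.
  by rewrite (eq_integral (fun x => (((B r : T -> R) \* B r) x)%:E)) ?E ?ltry.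
apply: (@le_integrable _ _ _ P setT measurableT _
  (fun x => (B t x * B t x)%:E + (B s x * B s x)%:E)%E).
- by apply/measurable_EFinP; apply: measurable_funM.
- move=> x _; rewrite -EFinD !abse_EFin lee_fin.
  rewrite [leRHS]ger0_norm ?addr_ge0 -?expr2 ?sqr_ge0// ler_norml.
  have h1 := sqr_ge0 (B t x - B s x); have h2 := sqr_ge0 (B t x + B s x).
  have h3 := sqr_ge0 (B t x); have h4 := sqr_ge0 (B s x).
  by apply/andP; split; nra.
- by apply: integrableD => //; exact: sq.
Qed.

Lemma expectation_step_sqr l :
  (\int[P]_x (step_rv l x ^+ 2)%:E)%E = (step_var l)%:E.
Proof.
rewrite /step_var.
rewrite -(@integral_quadratic_form _ _ _ P setT measurableT _ _ (fun z => z.1)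
  (fun y z x => B y.2 x * B z.2 x) (fun y z => fbm_cov y.2 z.2)).
- apply: eq_integral => x _; congr (_%:E).
  rewrite /step_rv expr2 mulr_suml; apply: eq_bigr => y _.
  by rewrite mulr_sumr; apply: eq_bigr => z _; ring.
- by move=> y z; exact: integrable_fbmM.
- by move=> y z; have [_ _ _ /(_ y.2 z.2)] := hB; rewrite unlock.
Qed.

Lemma measurable_step_rv l : measurable_fun setT (step_rv l).
Proof.
apply: measurable_sum => z; exact: measurable_funM.
Qed.

Lemma integral_cos_defect k t :
  (\int[mu]_(w in pos) (cos_defect H 1 w)%:E)%E = k%:E ->
  (\int[mu]_(w in pos) (cos_defect H t w)%:E)%E = (k * `|t| `^ (2 * H))%:E.
Proof.
case/andP: H01 => H0 H1 kE.
have pE (r : R) : 0 < r -> (\int[mu]_(w in pos) (cos_defect H r w)%:E)%E = (k * `|r| `^ (2 * H))%:E.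
  by move=> r0; rewrite integral_cos_defect_scale// kE -EFinM mulrC gtr0_norm.
have [t0|t0|->] := ltgtP t 0; last 2 first.
- exact: pE.
- rewrite normr0 powR0 ?mulr0; last by rewrite mulf_neq0// gt_eqF.
  by apply: integral0_eq => w _; rewrite /cos_defect mul0r cos0 subrr mul0r.
rewrite -normrN -pE ?oppr_gt0//; apply: eq_integral => w _.
by rewrite /cos_defect mulNr cosN.
Qed.

(** With a and b the two angles, (1 - cos a) (1 - cos b) + sin a sin b = (1 - cos a) + (1 - cos b) -
    (1 - cos(a - b)). This has the shape of [fbm_cov], each |t|^(2H) being replaced by a function
    with integral k |t|^(2H). *)
Lemma sqnormC_step_fourier l w : sqnormC (step_fourier l w) * fbm_weight H w =
  \sum_(y <- l) \sum_(z <- l) y.1 * z.1 *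
    (cos_defect H y.2 w + cos_defect H z.2 w - cos_defect H (y.2 - z.2) w).
Proof.
have reE : complex.Re (step_fourier l w) = \sum_(z <- l) z.1 * (cos (z.2 * w) - 1).
  rewrite /step_fourier; elim: l => [|z l IH]; rewrite ?big_nil ?big_cons//.
  by rewrite complexReD IH complexReM/= mul0r subr0.
have imE : complex.Im (step_fourier l w) = \sum_(z <- l) z.1 * sin (z.2 * w).
  rewrite /step_fourier; elim: l {reE} => [|z l IH]; rewrite ?big_nil ?big_cons//.
  by rewrite complexImD IH complexImM/= mul0r addr0 subr0.
rewrite /sqnormC reE imE !expr2 !mulr_suml -big_split mulr_suml; apply: eq_bigr => y _ /=.
rewrite !mulr_sumr -big_split mulr_suml; apply: eq_bigr => z _ /=.
by rewrite /cos_defect [(y.2 - z.2) * w]mulrBl cosB; ring.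
Qed.

Lemma integrable_cos_defect k t :
  (\int[mu]_(w in pos) (cos_defect H 1 w)%:E)%E = k%:E ->
  mu.-integrable pos (fun w => (cos_defect H t w)%:E).
Proof.
move=> kE; apply/integrableP; split.
  by apply/measurable_EFinP; exact: measurable_cos_defect.
under eq_integral => x _ do rewrite gee0_abs ?lee_fin ?cos_defect_ge0//.
by rewrite (integral_cos_defect _ kE) ltry.
Qed.

Lemma step_isometry k l :
  (\int[mu]_(w in pos) (cos_defect H 1 w)%:E)%E = k%:E ->
  (\int[mu]_(w in pos) (sqnormC (step_fourier l w) * fbm_weight H w)%:E)%E =
  (2 * k * step_var l)%:E.
Proof.
move=> kE; under eq_integral do rewrite sqnormC_step_fourier.
rewrite (@integral_quadratic_form _ _ _ mu pos mpos _ l (fun z => z.1)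
  (fun y z w => cos_defect H y.2 w + cos_defect H z.2 w - cos_defect H (y.2 - z.2) w)
  (fun y z => 2 * k * fbm_cov y.2 z.2)).
- congr (_%:E); rewrite /step_var mulr_sumr; apply: eq_bigr => y _.
  by rewrite mulr_sumr; apply: eq_bigr => z _; ring.
- move=> y z; under [X in integrable _ _ X]funext do rewrite EFinB EFinD.
  by apply: integrableB => //; [apply: integrableD => //|]; exact: (integrable_cos_defect _ kE).
- move=> y z; under eq_integral do rewrite EFinB EFinD.
  rewrite integralB//; last 2 first.
  - by apply: integrableD => //; exact: (integrable_cos_defect _ kE).
  - exact: (integrable_cos_defect _ kE).
  rewrite integralD//; last 2 first.
  - exact: (integrable_cos_defect _ kE).
  - exact: (integrable_cos_defect _ kE).
  rewrite !(integral_cos_defect _ kE) -[LHS]/((k * _ + k * _ - k * _)%:E).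
  by congr (_%:E); rewrite /fbm_cov; field.
Qed.

Lemma measurable_step_fourier l (D : set R) : measurable_fun D (fun w => complex.Re (step_fourier l w)) /\
  measurable_fun D (fun w => complex.Im (step_fourier l w)).
Proof.
split.
  rewrite (_ : (fun w => _) = (fun w => \sum_(z <- l) z.1 * (cos (z.2 * w) - 1))).
    apply: measurable_funTS; apply: measurable_sum => z; apply: measurable_funM => //.
    by apply: measurable_funB => //; exact: measurable_cos_scale.
  apply/funext => w; rewrite /step_fourier; elim: l => [|z l IH]; rewrite ?big_nil ?big_cons//.
  by rewrite complexReD IH complexReM/= mul0r subr0.
rewrite (_ : (fun w => _) = (fun w => \sum_(z <- l) z.1 * sin (z.2 * w))).
  apply: measurable_funTS; apply: measurable_sum => z; apply: measurable_funM => //.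
  by apply: (measurableT_comp (f := @sin R)) => //; apply: continuous_measurable_fun; exact: continuous_sin.
apply/funext => w; rewrite /step_fourier; elim: l => [|z l IH]; rewrite ?big_nil ?big_cons//.
by rewrite complexImD IH complexImM/= mul0r addr0 subr0.
Qed.

Lemma step_rv_cat l1 l2 x : step_rv (l1 ++ l2) x = step_rv l1 x + step_rv l2 x.
Proof. by rewrite /step_rv big_cat. Qed.

Lemma step_fourier_cat l1 l2 w :
  step_fourier (l1 ++ l2) w = step_fourier l1 w + step_fourier l2 w.
Proof. by rewrite /step_fourier big_cat. Qed.

Definition step_scale (c : R) (l : seq (R * R)) := [seq (c * z.1, z.2) | z <- l].

Lemma step_rv_scale c l x : step_rv (step_scale c l) x = c * step_rv l x.
Proof.
by rewrite /step_rv big_map mulr_sumr; apply: eq_bigr => z _; rewrite mulrA.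
Qed.

Lemma step_fourier_scale c l w : step_fourier (step_scale c l) w = c%:C%C * step_fourier l w.
Proof.
by rewrite /step_fourier big_map mulr_sumr; apply: eq_bigr => z _; rewrite rmorphM mulrA.
Qed.

(** The pointwise limit f is shown to be the L^2 limit of the images: the isometry makes them
    Cauchy, and Fatou in one index bounds the distance from f to each of them. The norms on both
    sides are then limits of the same step variances. *)
Lemma step_isometry_cvg k (l : nat -> seq (R * R)) (I : {RV P >-> R}) (e : R^nat) (f : R -> R[i]) :
  0 < k -> (\int[mu]_(w in pos) (cos_defect H 1 w)%:E)%E = k%:E ->
  (forall n, 0 <= e n) -> e n @[n --> \oo] --> 0 ->
  (forall n, \int[P]_x ((step_rv (l n) x - I x) ^+ 2)%:E <= (e n)%:E)%E ->
  (forall w, 0 < w -> cvgC (fun n => step_fourier (l n) w) (f w)) ->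
  exists2 a : R, (\int[P]_x (I x ^+ 2)%:E = a%:E)%E &
    mu.-integrable pos (fun w => (sqnormC (f w) * fbm_weight H w)%:E) /\
    (\int[mu]_(w in pos) (sqnormC (f w) * fbm_weight H w)%:E = (2 * k * a)%:E)%E.
Proof.
move=> k0 kE e0 ecvg le_e lf.
have mS n : measurable_fun setT (fun x => step_rv (l n) x ^+ 2).
  by apply: measurable_funX; exact: measurable_step_rv.
have mI : measurable_fun setT (fun x => I x ^+ 2) by apply: measurable_funX.
have mSI n : measurable_fun setT (fun x => (step_rv (l n) x - I x) ^+ 2).
  by apply: measurable_funX; apply: measurable_funB => //; exact: measurable_step_rv.
have mW : measurable_fun pos (fbm_weight H).
  by apply: measurable_funTS; exact: measurable_powR.
have msq (g : R -> R[i]) : measurable_fun pos (fun w => complex.Re (g w)) ->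
    measurable_fun pos (fun w => complex.Im (g w)) ->
    measurable_fun pos (fun w => sqnormC (g w) * fbm_weight H w).
  move=> m1 m2; apply: measurable_funM => //.
  by apply: measurable_funD; apply: measurable_funX.
have mf' : measurable_fun pos (fun w => complex.Re (f w)) /\ measurable_fun pos (fun w => complex.Im (f w)).
  split.
    apply: (@measurable_fun_cvg _ _ _ pos (fun n w => complex.Re (step_fourier (l n) w))) => [n|w].
      by have [] := measurable_step_fourier (l n) pos.
    by rewrite /= in_itv/= andbT => w0; have [] := lf w w0.
  apply: (@measurable_fun_cvg _ _ _ pos (fun n w => complex.Im (step_fourier (l n) w))) => [n|w].
    by have [] := measurable_step_fourier (l n) pos.
  by rewrite /= in_itv/= andbT => w0; have [] := lf w w0.
have mf := msq f mf'.1 mf'.2.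
have sq0 (g : R -> R[i]) w : 0 <= sqnormC (g w) * fbm_weight H w.
  by rewrite mulr_ge0 ?sqnormC_ge0 ?powR_ge0.
(* A difference of step sums is again a step sum, so its variance is carried to the Fourier side by
   the isometry. *)
have stepD n m x : (step_rv (l m ++ step_scale (- 1) (l n)) x) = step_rv (l m) x - step_rv (l n) x.
  by rewrite step_rv_cat step_rv_scale mulN1r.
have stepFD n m w : step_fourier (l m ++ step_scale (- 1) (l n)) w =
    step_fourier (l m) w - step_fourier (l n) w.
  by rewrite step_fourier_cat step_fourier_scale rmorphN1 mulN1r.
have var_diff n m : step_var (l m ++ step_scale (- 1) (l n)) <= 2 * e m + 2 * e n.
  rewrite -lee_fin -expectation_step_sqr.
  have := @integral_young_le _ _ _ P setT measurableT
     (fun x => step_rv (l m ++ step_scale (- 1) (l n)) x ^+ 2)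
     (fun x => (step_rv (l m) x - I x) ^+ 2) (fun x => (step_rv (l n) x - I x) ^+ 2) 1 (e n) ltr01.
  rewrite invr1 => h.
  apply: (le_trans (h _ (mSI m) (mSI n) _ _ _ _ (le_e n))).
  - by apply: measurable_funX; exact: measurable_step_rv.
  - by move=> x _; rewrite sqr_ge0.
  - by move=> x _; rewrite sqr_ge0.
  - by move=> x _; rewrite sqr_ge0.
  - move=> x _; rewrite stepD.
    have := sqr_ge0 (step_rv (l m) x - I x + (step_rv (l n) x - I x)); nra.
  - rewrite [leRHS]EFinD; apply: leeD => //; rewrite [leRHS]EFinM; apply: lee_pmul => //.
    by apply: integral_ge0 => x _; rewrite lee_fin sqr_ge0.
(* Fatou as m tends to infinity, with n fixed. *)
have Nf n : (\int[mu]_(w in pos) (sqnormC (f w - step_fourier (l n) w) * fbm_weight H w)%:E <=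
    (2 * k * (2 * e n))%:E)%E.
  apply: (@fatou_bound _ _ _ mu pos mpos (fun m w => sqnormC (step_fourier (l m) w - step_fourier (l n) w) * fbm_weight H w)
    _ (fun m => 2 * k * (2 * e m + 2 * e n))).
  - move=> m; rewrite (_ : (fun w => _) = (fun w =>
        sqnormC (step_fourier (l m ++ step_scale (- 1) (l n)) w) * fbm_weight H w)); last first.
      by apply/funext => w; rewrite stepFD.
    by apply: msq; have [] := measurable_step_fourier (l m ++ step_scale (- 1) (l n)) pos.
  - by move=> m w _; rewrite mulr_ge0 ?sqnormC_ge0 ?powR_ge0.
  - move=> w; rewrite /= in_itv/= andbT => w0; apply: cvgMl.
    by apply: cvgC_sqnorm; apply: cvgCD; [exact: lf|exact: cvgC_cst].
  - move=> m; rewrite [leLHS](_ : _ = (2 * k * step_var (l m ++ step_scale (- 1) (l n)))%:E).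
      by rewrite lee_fin ler_wpM2l ?mulr_ge0 ?(ltW k0).
    by rewrite -(step_isometry _ kE); apply: eq_integral => w _; rewrite stepFD.
  - rewrite -[X in _ --> 2 * k * X]add0r; apply: cvgMr; apply: cvgD; last exact: cvg_cst.
    by rewrite -(mulr0 2); apply: cvgMr.
pose a0 := (\int[P]_x (I x ^+ 2)%:E)%E.
pose b0 := (\int[mu]_(w in pos) (sqnormC (f w) * fbm_weight H w)%:E)%E.
have a0_ge0 : (0 <= a0)%E by apply: integral_ge0 => x _; rewrite lee_fin sqr_ge0.
have b0_ge0 : (0 <= b0)%E by apply: integral_ge0 => x _; rewrite lee_fin sq0.
have mstep n := measurable_step_fourier (l n) pos.
have mdiff n : measurable_fun pos (fun w => sqnormC (f w - step_fourier (l n) w) * fbm_weight H w).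
  apply: msq.
    rewrite (_ : (fun _ => _) = (fun w => complex.Re (f w) - complex.Re (step_fourier (l n) w))).
      by apply: measurable_funB; [exact: mf'.1|exact: (mstep n).1].
    by apply/funext => w; case: (f w) => x y; case: (step_fourier _ _).
  rewrite (_ : (fun _ => _) = (fun w => complex.Im (f w) - complex.Im (step_fourier (l n) w))).
    by apply: measurable_funB; [exact: mf'.2|exact: (mstep n).2].
  by apply/funext => w; case: (f w) => x y; case: (step_fourier _ _).
have mstepW n : measurable_fun pos (fun w => sqnormC (step_fourier (l n) w) * fbm_weight H w).
  by apply: msq; [exact: (mstep n).1|exact: (mstep n).2].
have ISle n eta : 0 < eta -> (a0 <= ((1 + eta) * step_var (l n) + (1 + eta^-1) * e n)%:E)%E.
  move=> eta0; rewrite EFinD EFinM -expectation_step_sqr.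
  apply: (@integral_young_le _ _ _ P setT measurableT _ _ (fun x => (step_rv (l n) x - I x) ^+ 2)) => //.
  - by move=> x _; rewrite sqr_ge0.
  - by move=> x _; rewrite sqr_ge0.
  - by move=> x _; rewrite sqr_ge0.
  - move=> x _; have := sqrrD_young (step_rv (l n) x) (I x - step_rv (l n) x) eta0.
    by rewrite addrC subrK -[(I x - _) ^+ 2]sqrrN opprB.
have SIle n eta : 0 < eta -> ((step_var (l n))%:E <= (1 + eta)%:E * a0 + ((1 + eta^-1) * e n)%:E)%E.
  move=> eta0; rewrite -expectation_step_sqr.
  apply: (@integral_young_le _ _ _ P setT measurableT _ _ (fun x => (step_rv (l n) x - I x) ^+ 2)) => //.
  - by move=> x _; rewrite sqr_ge0.
  - by move=> x _; rewrite sqr_ge0.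
  - by move=> x _; rewrite sqr_ge0.
  - move=> x _; have := sqrrD_young (I x) (step_rv (l n) x - I x) eta0.
    by rewrite addrC subrK.
have FSle n eta : 0 < eta -> (b0 <= ((1 + eta) * (2 * k * step_var (l n)) + (1 + eta^-1) * (2 * k * (2 * e n)))%:E)%E.
  move=> eta0; rewrite EFinD [X in (X + _)%E]EFinM -(step_isometry _ kE).
  apply: (@integral_young_le _ _ _ mu pos mpos _ _
    (fun w => sqnormC (f w - step_fourier (l n) w) * fbm_weight H w)) => //;
    try by move=> w _; rewrite mulr_ge0 ?sqnormC_ge0 ?powR_ge0.
  - exact: mstepW.
  - exact: mdiff.
  move=> w _.
  rewrite !mulrA -mulrDl ler_wpM2r ?powR_ge0//.
  have := sqnormC_young (step_fourier (l n) w) (f w - step_fourier (l n) w) eta0.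
  by rewrite addrC subrK.
have SFle n eta : 0 < eta -> ((2 * k * step_var (l n))%:E <= (1 + eta)%:E * b0 + ((1 + eta^-1) * (2 * k * (2 * e n)))%:E)%E.
  move=> eta0; rewrite -(step_isometry _ kE).
  apply: (@integral_young_le _ _ _ mu pos mpos _ _
    (fun w => sqnormC (f w - step_fourier (l n) w) * fbm_weight H w)) => //;
    try by move=> w _; rewrite mulr_ge0 ?sqnormC_ge0 ?powR_ge0.
  - exact: mstepW.
  - exact: mdiff.
  move=> w _.
  rewrite !mulrA -mulrDl ler_wpM2r ?powR_ge0//.
  have := sqnormC_young (f w) (step_fourier (l n) w - f w) eta0.
  by rewrite addrC subrK -[step_fourier (l n) w - f w]opprB sqnormCN.
(* One index with eta = 1 suffices for the finiteness of both norms. *)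
have afin : a0 \is a fin_num by rewrite ge0_fin_numE// (le_lt_trans (ISle 0%N 1 ltr01)) ?ltry.
have bfin : b0 \is a fin_num by rewrite ge0_fin_numE// (le_lt_trans (FSle 0%N 1 ltr01)) ?ltry.
exists (fine a0); first by rewrite fineK.
split.
  apply/integrableP; split; first exact/measurable_EFinP.
  under eq_integral => x _ do rewrite gee0_abs ?lee_fin ?mulr_ge0 ?sqnormC_ge0 ?powR_ge0//.
  by rewrite -/b0 -(fineK bfin) ltry.
rewrite -/b0 -(fineK bfin); congr (_%:E).
have vge0 n : 0 <= step_var (l n).
  by rewrite -lee_fin -expectation_step_sqr; apply: integral_ge0 => x _; rewrite lee_fin sqr_ge0.
have ca : step_var (l n) @[n --> \oo] --> fine a0.
  apply: (@quadratic_cvg _ _ e) => //.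
  - by rewrite fine_ge0.
  - by move=> n eta eta0; have := SIle n eta eta0; rewrite -{1}(fineK afin) -EFinM -EFinD lee_fin.
  - by move=> n eta eta0; have := ISle n eta eta0; rewrite -{1}(fineK afin) lee_fin.
have cb : 2 * k * step_var (l n) @[n --> \oo] --> fine b0.
  apply: (@quadratic_cvg _ _ (fun n => 2 * k * (2 * e n))) => //.
  - by rewrite fine_ge0.
  - by move=> n; rewrite !mulr_ge0// ltW.
  - by move=> n; rewrite !mulr_ge0// ltW.
  - suff : 2 * k * (2 * e n) @[n --> \oo] --> 2 * k * (2 * 0) by rewrite !mulr0.
    by apply: cvgMr; apply: cvgMr.
  - by move=> n eta eta0; have := SFle n eta eta0; rewrite -{1}(fineK bfin) -EFinM -EFinD lee_fin.
  - by move=> n eta eta0; have := FSle n eta eta0; rewrite -{1}(fineK bfin) lee_fin.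
(* The sequence 2k [step_var (l n)] tends both to the weighted norm of f and to 2k times the second
   moment of I. *)
by apply: (cvg_unique _ cb) => //; apply: cvgMr.
Qed.

End spectral_isometry.

(** * Integrals over the line from the two half-lines *)

Section reflection.
Variable R : realType.
Local Notation mu := (@lebesgue_measure R).
Local Notation pos := (`]0%R, +oo[%classic : set R).
Local Notation neg := (`]-oo, 0%R[%classic : set R).

Let mpos : measurable pos. Proof. exact: measurable_itv. Qed.
Let mneg : measurable neg. Proof. exact: measurable_itv. Qed.

(** Pushforward under negation, which preserves Lebesgue measure. The integrand is first extended by
    zero, to be measurable on the whole line. *)
Lemma integral_reflect (f : R -> R) : mu.-integrable pos (fun x => (f (- x))%:E) ->
  mu.-integrable neg (fun x => (f x)%:E) /\
  (\int[mu]_(x in neg) (f x)%:E = \int[mu]_(x in pos) (f (- x))%:E)%E.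
Proof.
move=> fi; pose g := (fun x => (f (- x))%:E) \_ pos.
have gi : mu.-integrable setT g.
  by have /(_ mpos)[+ _] := @integrable_mkcond _ _ _ mu pos (fun x : R => (f (- x))%:E); apply.
have mg : measurable_fun setT g by exact: measurable_int gi.
have mopp : measurable_fun [set: measurableTypeR R] (-%R : measurableTypeR R -> measurableTypeR R).
  exact: oppr_measurable.
have preE : -%R @^-1` pos = neg.
  by apply/seteqP; split => x /=; rewrite !in_itv/= ?andbT oppr_gt0.
have gE x : neg x -> g (- x) = (f x)%:E.
  move=> nx; rewrite /g patchT ?opprK// inE.
  by move: nx; rewrite /= !in_itv/= andbT oppr_gt0.
have gP x : pos x -> g x = (f (- x))%:E by move=> px; rewrite /g patchT// inE.
have pushE (F : R -> \bar R) : measurable_fun setT F ->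
    (\int[pushforward mu (-%R : _ -> measurableTypeR R)]_(x in pos) F x = \int[mu]_(x in pos) F x)%E.
  by move=> mF; apply: eq_measure_integral => A mA _; exact: lebesgue_measureN.
have ineg : mu.-integrable neg (g \o -%R).
  apply/integrableP; split.
    by apply: measurable_funTS; apply: (measurableT_comp mg).
  have -> : (\int[mu]_(x in neg) `|(g \o -%R) x| = \int[mu]_(x in pos) `|g x|)%E.
    rewrite -pushE; last exact: measurableT_comp.
    rewrite (@ge0_integral_pushforward _ _ (measurableTypeR R) (measurableTypeR R) R -%R mopp mu pos)//.
    - by rewrite preE.
    - by apply: measurable_funTS; exact: measurableT_comp.
  have /integrableP[_] := fi; apply: le_lt_trans.
  by under eq_integral => x /set_mem px do rewrite gP//.
split.
  by apply: eq_integrable ineg => // x /set_mem nx /=; rewrite gE.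
transitivity (\int[mu]_(x in neg) (g \o -%R) x)%E.
  by apply: eq_integral => x /set_mem nx /=; rewrite gE.
transitivity (\int[mu]_(x in pos) g x)%E; last first.
  by apply: eq_integral => x /set_mem px; rewrite gP.
rewrite -(pushE g mg).
rewrite (@integral_pushforward _ _ (measurableTypeR R) (measurableTypeR R) R -%R mopp mu pos g mg)// preE//.
Qed.

(** The origin, the only point of neither half-line, is a null set. *)
Lemma integral_symmetrize (f : R -> R) :
  mu.-integrable pos (fun x => (f x)%:E) -> mu.-integrable pos (fun x => (f (- x))%:E) ->
  mu.-integrable setT (fun x => (f x)%:E) /\
  (\int[mu]_x (f x)%:E = \int[mu]_(x in pos) (f x)%:E + \int[mu]_(x in pos) (f (- x))%:E)%E.
Proof.
move=> fp fn; have [ineg Eneg] := integral_reflect fn.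
have TE : [set: R] = neg `|` [set 0] `|` pos.
  apply/seteqP; split => // x _ /=; rewrite !in_itv/= andbT.
  by case: (ltgtP x 0) => [?|?|->]; [left; left|right|left; right].
have m0 : measurable ([set 0] : set R) by [].
have d1 : [disjoint neg & [set 0]].
  by apply/disj_setPS => x [] /=; rewrite in_itv/= => /[swap] ->; rewrite ltxx.
have d2 : [disjoint neg `|` [set 0] & pos].
  apply/disj_setPS => x [] /= [|->]; rewrite !in_itv/= ?ltxx// andbT => /lt_trans h /h.
  by rewrite ltxx.
have mT : measurable_fun [set: R] (fun x => (f x)%:E).
  rewrite TE; apply/measurable_funU => //; first exact: measurableU.
  split; last exact: measurable_int fp.
  apply/measurable_funU => //; split; first exact: measurable_int ineg.
  exact: measurable_fun_set1.
have splitE (F : R -> \bar R) : measurable_fun [set: R] F ->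
    (\int[mu]_x F x = \int[mu]_(x in neg) F x + \int[mu]_(x in pos) F x)%E.
  move=> mF; rewrite TE integral_setU//.
  - rewrite integral_setU//.
    + by rewrite integral_set1 adde0.
    + by apply: measurable_funTS.
  - exact: measurableU.
  - by apply: measurable_funTS.
split; last by rewrite splitE// addeC Eneg.
apply/integrableP; split => //; rewrite splitE; last exact: measurableT_comp.
by apply: lte_add_pinfty; [have /integrableP[] := ineg|have /integrableP[] := fp].
Qed.

End reflection.

(** * Approximation of the integral by uniform Riemann sums *)

Section riemann_approximation.
Context d (T : measurableType d) (R : realType) (P : probability T R).
Variables (B : R -> {RV P >-> R}).

(** Node i lies (m - i) h before t. With left endpoints as tags the lags are h, 2h, ..., mh, whence
    the exponents starting at 1 in the geometric sums. *)
Definition uniform_node (t h : R) (m i : nat) : R := t - (m%:R - i%:R) * h.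

(** Each increment is split into its two end values, since the lists record multiples of single
    variables B_t. *)
Definition riemann_step (g : R -> R) (t h : R) (m : nat) : seq (R * R) :=
  [seq (g (uniform_node t h m i), uniform_node t h m i.+1) | i <- index_iota 0 m] ++
  [seq (- g (uniform_node t h m i), uniform_node t h m i) | i <- index_iota 0 m].

Lemma step_rv_riemann g t h m x :
  step_rv B (riemann_step g t h m) x =
  riemann_sum g (fun t => B t : T -> R) m (uniform_node t h m) (uniform_node t h m) x.
Proof.
rewrite step_rv_cat /step_rv !big_map /riemann_sum -big_split/=.
rewrite big_mkord; apply: eq_bigr => i _.
by ring.
Qed.

Lemma step_fourier_riemann (k : R -> R) t h m w :
  step_fourier (riemann_step (fun u => k (t - u)) t h m) w =
  expi (t * w) * ((\sum_(j < m) (k (j.+1%:R * h))%:C%C * expi (- w * (j.+1%:R * h))) *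
    (expi (w * h) - 1)).
Proof.
rewrite step_fourier_cat /step_fourier !big_map -big_split/=.
(* Reversal turns the node index i into j = m - 1 - i, with lag (j + 1) h. *)
rewrite big_mkord (reindex_inj rev_ord_inj)/=.
rewrite mulr_suml mulr_sumr; apply: eq_bigr => j _.
have jm : ((m - j.+1)%N%:R : R) = m%:R - j.+1%:R by rewrite natrB.
have E0 : uniform_node t h m (m - j.+1) = t - j.+1%:R * h.
  by rewrite /uniform_node jm; ring.
have E1 : uniform_node t h m (m - j.+1).+1 = t - j.+1%:R * h + h.
  by rewrite /uniform_node -[(m - j.+1).+1%:R]natr1 jm; ring.
rewrite E0 E1 opprB addrCA subrr addr0.
have -> : (t - j.+1%:R * h + h) * w = t * w + - w * (j.+1%:R * h) + w * h by ring.
have -> : (t - j.+1%:R * h) * w = t * w + - w * (j.+1%:R * h) by ring.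
by rewrite !expiD rmorphN/=; ring.
Qed.

Lemma tagged_partition_uniform t h delta m : 0 <= h < delta ->
  tagged_partition (t - m%:R * h) t delta m (uniform_node t h m) (uniform_node t h m).
Proof.
move=> /andP[h0 hd]; split; rewrite /uniform_node.
- by rewrite subr0.
- by rewrite subrr mul0r subr0.
- move=> i im; rewrite -natr1; split.
    by rewrite lexx/=; lra.
  by have -> : t - (m%:R - (i%:R + 1)) * h - (t - (m%:R - i%:R) * h) = h by ring.
Qed.

(** Truncate at some a <= t - (n + 1) within 1 / (n + 1) of the full integral, then partition [a, t]
    finely enough. The bounds on h and mh make the mesh vanish and the length grow along one
    sequence. *)
Lemma ms_integral_step (k : R -> R) (t : R) (I : {RV P >-> R}) (n : nat) :
  is_ms_integral_ninfty B (fun u => k (t - u)) t I ->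
  exists hm : R * nat,
    [/\ 0 < hm.1 <= n.+1%:R^-1, n.+1%:R <= hm.2%:R * hm.1 &
      (\int[P]_x ((step_rv B (riemann_step (fun u => k (t - u)) t hm.1 hm.2) x - I x) ^+ 2)%:E
        <= (4 * n.+1%:R^-1)%:E)%E].
Proof.
move=> [J [Jint Jcvg]].
have n0 : (0 : R) < n.+1%:R^-1 by rewrite invr_gt0.
have [a [at_ aJ]] : exists a, a <= t - n.+1%:R /\ (ms_dist P (J a) I <= n.+1%:R^-1%:E)%E.
  have Jle : \forall a \near -oo%R, (ms_dist P (J a) I <= n.+1%:R^-1%:E)%E.
    have /fine_cvgP[Jfin /cvgrPdist_le/(_ _ n0) Jle] := Jcvg.
    apply: filterS2 Jfin Jle => a af; rewrite sub0r normrN => /(le_trans (ler_norm _)).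
    by rewrite /= -lee_fin fineK.
  near (-oo%R : set_system R) => a; exists a; split.
    by near: a; exact: nbhs_ninfty_le (num_real _).
  by near: a.
have ta0 : 0 < t - a.
  have : (0 : R) < n.+1%:R by []. by move: at_; lra.
have [delta delta0 dP] := Jint a ltac:(by apply: le_trans at_ _; rewrite gerBl) n.+1%:R^-1 n0.
pose e := Num.min delta n.+1%:R^-1.
have e0 : 0 < e by rewrite lt_min delta0.
(* Truncation plus one exceeds (t - a) / e strictly, so the mesh is below e. *)
pose m := (Num.Def.trunc ((t - a) / e)).+1.
have m0 : (0 : R) < m%:R by [].
have hE : m%:R * ((t - a) / m%:R) = t - a by rewrite mulrC divfK// gt_eqF.
have he : (t - a) / m%:R < e.
  by rewrite ltr_pdivrMr// mulrC -ltr_pdivrMr// truncnS_gt.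
exists ((t - a) / m%:R, m); split => /=.
- by rewrite divr_gt0//= (le_trans (ltW he))// ge_min lexx orbT.
- by rewrite hE; move: at_; lra.
have hd : 0 <= (t - a) / m%:R < delta.
  by rewrite divr_ge0 ?(ltW ta0) ?(ltW m0)//= (lt_le_trans he)// ge_min lexx.
have TP := tagged_partition_uniform t m hd.
rewrite (_ : t - m%:R * ((t - a) / m%:R) = a) in TP; last by rewrite hE; ring.
have := dP _ _ _ TP.
move=> SJ.
have ge0 (X Z : T -> R) : (0 <= \int[P]_x ((X x - Z x) ^+ 2)%:E)%E.
  by apply: integral_ge0 => x _; rewrite lee_fin sqr_ge0.
rewrite /ms_dist unlock in SJ aJ.
have mS l : measurable_fun setT (step_rv B l) by exact: measurable_step_rv.
have := @integral_young_le _ _ _ P setT measurableT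
  (fun x => (step_rv B (riemann_step (fun u => k (t - u)) t ((t - a) / m%:R) m) x - I x) ^+ 2)
  (fun x => (step_rv B (riemann_step (fun u => k (t - u)) t ((t - a) / m%:R) m) x - J a x) ^+ 2)
  (fun x => (J a x - I x) ^+ 2) 1 n.+1%:R^-1 ltr01.
rewrite invr1 => h; apply: (le_trans (h _ _ _ _ _ _ _ _)).
- by apply: measurable_funX; apply: measurable_funB.
- by apply: measurable_funX; apply: measurable_funB.
- by apply: measurable_funX; apply: measurable_funB.
- by move=> x _; exact: sqr_ge0.
- by move=> x _; exact: sqr_ge0.
- by move=> x _; exact: sqr_ge0.
- move=> x _; set u := step_rv _ _ _.
  have := sqr_ge0 (u - J a x - (J a x - I x)); nra.
- exact: aJ.
(* Each of the two errors is at most 1 / (n + 1) and gets doubled by (a + b)^2 <= 2 a^2 + 2 b^2. *)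
rewrite (_ : 4 * n.+1%:R^-1 = (1 + 1) * n.+1%:R^-1 + (1 + 1) * n.+1%:R^-1 :> R); last by ring.
rewrite [leRHS]EFinD; apply: leeD => //; rewrite [leRHS]EFinM; apply: lee_pmul => //.
apply: le_trans (ltW SJ); rewrite le_eqVlt; apply/orP; left; apply/eqP.
by apply: eq_integral => x _; rewrite step_rv_riemann.
Unshelve. all: end_near. Qed.

Lemma ms_integral_approx (k : R -> R) (t : R) (I : {RV P >-> R}) :
  is_ms_integral_ninfty B (fun u => k (t - u)) t I ->
  exists h : nat -> R, exists m : nat -> nat, forall n,
    [/\ 0 < h n <= n.+1%:R^-1, n.+1%:R <= (m n)%:R * h n &
      (\int[P]_x ((step_rv B (riemann_step (fun u => k (t - u)) t (h n) (m n)) x - I x) ^+ 2)%:E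
        <= (4 * n.+1%:R^-1)%:E)%E].
Proof.
move=> kI; have [hm hmP] := choice (fun n => ms_integral_step n kI).
by exists (fun n => (hm n).1), (fun n => (hm n).2).
Qed.

End riemann_approximation.

(** * Square-integrable variables and mean-square limits *)

Section second_moments.
Context d (T : measurableType d) (R : realType) (P : probability T R).

Lemma Lfun2_sqr (f : T -> R) (a : R) : measurable_fun setT f ->
  (\int[P]_x (f x ^+ 2)%:E = a%:E)%E -> f \in Lfun P 2%:E.
Proof.
move=> mf fa; rewrite inE; apply/andP; split; rewrite inE//=.
rewrite /finite_norm unlock /=; apply: poweR_lty.
rewrite (eq_integral (fun x => (f x ^+ 2)%:E)) ?fa ?ltry// => x _.
by rewrite /= powR_mulrn// real_normK ?num_real.
Qed.

Lemma Lfun2_integrable (f : T -> R) : f \in Lfun P 2%:E -> P.-integrable setT (EFin \o f).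
Proof.
by move=> f2; apply/Lfun1_integrable/(Lfun_subset12 _ f2); rewrite fin_num_measure.
Qed.

Lemma Lfun2_integrableM (f g : T -> R) : f \in Lfun P 2%:E -> g \in Lfun P 2%:E ->
  P.-integrable setT (fun x => (f x * g x)%:E).
Proof. by move=> f2 g2; apply/(Lfun1_integrable P (f \* g))/Lfun2_mul_Lfun1. Qed.

(** |E I| = |E (I - X n)| is bounded through |u| <= eta + u^2 / eta, in place of the Cauchy-Schwarz
    inequality. *)
Lemma mean_zero_L2_limit (X : nat -> T -> R) (I : T -> R) (e : R^nat) :
  (forall n, X n \in Lfun P 2%:E) -> I \in Lfun P 2%:E ->
  (forall n, \int[P]_x (X n x)%:E = 0)%E ->
  (forall n, \int[P]_x ((X n x - I x) ^+ 2)%:E <= (e n)%:E)%E ->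
  e n @[n --> \oo] --> 0 -> (\int[P]_x (I x)%:E = 0)%E.
Proof.
move=> X2 I2 X0 XI e0.
have iI := Lfun2_integrable I2.
have Ifin : (\int[P]_x (I x)%:E)%E \is a fin_num by exact: integrable_fin_num.
rewrite -(fineK Ifin); congr (_%:E); set r := fine _.
have key n (eta : R) : 0 < eta -> `|r| <= eta + e n / eta.
  move=> eta0.
  have iX := Lfun2_integrable (X2 n).
  have DE : (\int[P]_x (I x - X n x)%:E = r%:E)%E.
    under eq_integral do rewrite EFinB.
    by rewrite integralB// X0 sube0 -(fineK Ifin).
  have iD : P.-integrable setT (fun x => (I x - X n x)%:E).
    by apply: (eq_integrable _ _ _ _ (integrableB _ iI iX)).
  have mD : measurable_fun setT (fun x => I x - X n x).
    by apply/measurable_EFinP; case/integrableP: iD.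
  have iD2 : P.-integrable setT (fun x => ((I x - X n x) ^+ 2)%:E).
    apply/integrableP; split; first by apply/measurable_EFinP; apply: measurable_funX.
    apply: (@le_lt_trans _ _ (e n)%:E); last by rewrite ltry.
    apply: le_trans (XI n); rewrite le_eqVlt; apply/orP; left; apply/eqP.
    apply: eq_integral => x _; rewrite gee0_abs ?lee_fin ?sqr_ge0//.
    by rewrite -sqrrN opprB.
  rewrite -lee_fin -abse_EFin -DE.
  apply: (le_trans (le_abse_integral _ _ _)) => //; first by case/integrableP: iD.
  apply: (@le_trans _ _ (\int[P]_x (eta%:E * cst 1 x + eta^-1%:E * ((I x - X n x) ^+ 2)%:E))%E).
    apply: ge0_le_integral => //.
    - by apply: measurableT_comp => //; case/integrableP: iD.
    - apply: emeasurable_funD => //; apply: emeasurable_funM => //.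
      by case/integrableP: iD2.
    - move=> x _; rewrite mule1 -EFinM -EFinD lee_fin.
      set u := I x - X n x.
      rewrite -(ler_pM2l eta0) mulrDr mulrA divff ?gt_eqF// mul1r.
      have := sqr_ge0 (`|u| - eta); rewrite -(real_normK (num_real u)).
      have := normr_ge0 u; nra.
  rewrite integralD//; last 2 first.
  - by apply: integrableZl => //; exact: finite_measure_integrable_cst.
  - exact: integrableZl.
  rewrite integralZl//; last exact: finite_measure_integrable_cst.
  have -> : (\int[P]_x cst 1 x = 1)%E.
    by rewrite integral_cst// mul1e; exact: probability_setT.
  rewrite mule1 integralZl//.
  rewrite EFinD; apply: leeD => //; rewrite EFinM muleC; apply: lee_pmul => //.
  - by apply: integral_ge0 => x _; rewrite lee_fin sqr_ge0.
  - by rewrite lee_fin invr_ge0 ltW.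
  - apply: le_trans (XI n); rewrite le_eqVlt; apply/orP; left; apply/eqP.
    by apply: eq_integral => x _; rewrite /= -sqrrN opprB.
apply/eqP; rewrite -normr_eq0 eq_le normr_ge0 andbT.
apply/ler_addgt0Pl => eta eta0; rewrite addr0.
have eta20 : 0 < eta / 2 by rewrite divr_gt0.
(* With e m <= (eta / 2)^2 and parameter eta / 2, both terms are at most eta / 2. *)
have /cvgrPdist_le/(_ (eta / 2 * (eta / 2)))/(_ _)[|m _ mP] := e0; first by rewrite mulr_gt0.
have := mP m (leqnn m); rewrite sub0r normrN => em.
apply: (le_trans (key m _ eta20)); rewrite [leRHS]splitr lerD2l ler_pdivrMr//.
exact: le_trans (ler_norm _) em.
Qed.

End second_moments.

(** * Covariances of limits of step sums *)

Section fbm_limits.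
Context d (T : measurableType d) (R : realType) (P : probability T R).
Variables (H : R) (B : R -> {RV P >-> R}).
Hypotheses (H01 : 0 < H < 1) (hB : is_fBm H B).
Local Notation mu := (@lebesgue_measure R).
Local Notation pos := (`]0%R, +oo[%classic : set R).

Let mpos : measurable pos. Proof. exact: measurable_itv. Qed.

Lemma step_rv_Lfun2 l : step_rv B l \in Lfun P 2%:E.
Proof.
by apply: (@Lfun2_sqr _ _ _ _ _ (step_var H l)); [exact: measurable_step_rv|exact: expectation_step_sqr].
Qed.

Lemma expectation_step l : (\int[P]_x (step_rv B l x)%:E = 0)%E.
Proof.
have iB t : P.-integrable setT (fun x => (B t x)%:E).
  apply: Lfun2_integrable; apply: (@Lfun2_sqr _ _ _ _ _ (fbm_cov H t t)) => //.
  have [_ _ _ /(_ t t)] := hB; rewrite unlock => <-.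
  by apply: eq_integral => x _.
have iz (z : R * R) : P.-integrable setT (fun x => z.1%:E * (B z.2 x)%:E)%E by exact: integrableZl.
under eq_integral => x _ do rewrite /step_rv -sumEFin.
rewrite (integral_sum _ iz)// big1// => z _.
rewrite integralZl//; have [_ _ /(_ z.2) + _] := hB.
by rewrite unlock => ->; rewrite mule0.
Qed.

(** Couples two limits along the same step sums: mean-square on the probability side, pointwise on
    the spectral side. *)
Definition step_limit (l : nat -> seq (R * R)) (e : R^nat) (I : T -> R) (f : R -> R[i]) : Prop :=
  [/\ forall n, 0 <= e n, e n @[n --> \oo] --> 0,
    forall n, (\int[P]_x ((step_rv B (l n) x - I x) ^+ 2)%:E <= (e n)%:E)%E &
    forall w, 0 < w -> cvgC (fun n => step_fourier (l n) w) (f w)].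

Variables (k : R).
Hypotheses (k0 : 0 < k) (kE : (\int[mu]_(w in pos) (cos_defect H 1 w)%:E)%E = k%:E).

(** The isometry gives norms only, so it is applied to I, J and I + J. The common g makes the norms
    of I and J equal, the phases having modulus 1. *)
Lemma step_limit_cov (g : R -> R[i]) (t s : R) (I J : {RV P >-> R}) l1 l2 e1 e2 :
  step_limit l1 e1 I (fun w => expi (t * w) * g w) ->
  step_limit l2 e2 J (fun w => expi (s * w) * g w) ->
  mu.-integrable pos (fun w => (cos ((t - s) * w) * (sqnormC (g w) * fbm_weight H w))%:E) /\
  ((2 * k)%:E * \int[P]_x (I x * J x)%:E =
    \int[mu]_(w in pos) (cos ((t - s) * w) * (sqnormC (g w) * fbm_weight H w))%:E)%E.
Proof.
move=> [e10 c1 I1 f1] [e20 c2 I2 f2].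
have [a aE [ia iaE]] := step_isometry_cvg H01 hB k0 kE e10 c1 I1 f1.
have [b bE [ib ibE]] := step_isometry_cvg H01 hB k0 kE e20 c2 I2 f2.
have mIJ n : measurable_fun setT (fun x => (step_rv B (l1 n) x - I x) ^+ 2) /\
   measurable_fun setT (fun x => (step_rv B (l2 n) x - J x) ^+ 2).
  by split; apply: measurable_funX; apply: measurable_funB => //; exact: measurable_step_rv.
have ge0e n : 0 <= 2 * e1 n + 2 * e2 n by rewrite addr_ge0// mulr_ge0.
have cvge : 2 * e1 n + 2 * e2 n @[n --> \oo] --> 0.
  suff : 2 * e1 n + 2 * e2 n @[n --> \oo] --> 2 * (0 : R) + 2 * (0 : R) by rewrite mulr0 addr0.
  by apply: cvgD; apply: cvgMr.
have IJe n : (\int[P]_x ((step_rv B (l1 n ++ l2 n) x - (I + J : {mfun T >-> R}) x) ^+ 2)%:E <=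
    (2 * e1 n + 2 * e2 n)%:E)%E.
  have := @integral_young_le _ _ _ P setT measurableT
    (fun x => (step_rv B (l1 n ++ l2 n) x - (I + J : {mfun T >-> R}) x) ^+ 2)
    (fun x => (step_rv B (l1 n) x - I x) ^+ 2) (fun x => (step_rv B (l2 n) x - J x) ^+ 2)
    1 (e2 n) ltr01.
  rewrite invr1 => h; apply: (le_trans (h _ (mIJ n).1 (mIJ n).2 _ _ _ _ (I2 n))).
  - apply: measurable_funX; apply: measurable_funB; last exact: measurable_funP.
    exact: measurable_step_rv.
  - by move=> x _; exact: sqr_ge0.
  - by move=> x _; exact: sqr_ge0.
  - by move=> x _; exact: sqr_ge0.
  - move=> x _; rewrite step_rv_cat.
    have -> : (I + J : {mfun T >-> R}) x = I x + J x by [].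
    have := sqr_ge0 (step_rv B (l1 n) x - I x - (step_rv B (l2 n) x - J x)); nra.
  - rewrite [leRHS]EFinD; apply: leeD => //; rewrite [leRHS]EFinM; apply: lee_pmul => //.
    by apply: integral_ge0 => x _; rewrite lee_fin sqr_ge0.
have f12 w : 0 < w -> cvgC (fun n => step_fourier (l1 n ++ l2 n) w)
    (expi (t * w) * g w + expi (s * w) * g w).
  move=> w0; apply: (cvgC_eq _ (cvgCD (f1 w w0) (f2 w w0))).
  by apply: nearW => n; rewrite step_fourier_cat.
have [c cE [ic icE]] := step_isometry_cvg H01 hB k0 kE ge0e cvge IJe f12.
pose Q w := sqnormC (g w) * fbm_weight H w.
have sqE r w : sqnormC (expi (r * w) * g w) * fbm_weight H w = Q w.
  by rewrite sqnormCM sqnormC_expi mul1r.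
(* |e^{itw} + e^{isw}|^2 = 2 + 2 cos((t - s)w). *)
have sumE w : sqnormC (expi (t * w) * g w + expi (s * w) * g w) * fbm_weight H w =
    2 * Q w + 2 * (cos ((t - s) * w) * Q w).
  rewrite -mulrDl sqnormCM /Q [(t - s) * w]mulrBl cosB.
  have -> : sqnormC (expi (t * w) + expi (s * w)) =
      2 + 2 * (cos (t * w) * cos (s * w) + sin (t * w) * sin (s * w)).
    rewrite /sqnormC complexReD complexImD/=.
    by have := cos2Dsin2 (t * w); have := cos2Dsin2 (s * w); nra.
  by ring.
have iQ : mu.-integrable pos (fun w => (Q w)%:E).
  by apply: eq_integrable ia => // w _; rewrite sqE.
have QE : (\int[mu]_(w in pos) (Q w)%:E = (2 * k * a)%:E)%E.
  by rewrite -iaE; apply: eq_integral => w _; rewrite sqE.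
have QE' : (\int[mu]_(w in pos) (Q w)%:E = (2 * k * b)%:E)%E.
  by rewrite -ibE; apply: eq_integral => w _; rewrite sqE.
have icos : mu.-integrable pos (fun w => (cos ((t - s) * w) * Q w)%:E).
  apply: (@le_integrable _ _ _ mu pos mpos _ (fun w => (Q w)%:E)) => //.
    apply/measurable_EFinP; apply: measurable_funM.
      by apply: measurable_funTS; exact: measurable_cos_scale.
    by apply/measurable_EFinP; exact: measurable_int iQ.
  by move=> w _; rewrite !abse_EFin lee_fin normrM ler_piMl// cos_max.
split=> //.
have I2' : (I : T -> R) \in Lfun P 2%:E by apply: (Lfun2_sqr _ aE).
have J2' : (J : T -> R) \in Lfun P 2%:E by apply: (Lfun2_sqr _ bE).
have iIJ := Lfun2_integrableM I2' J2'.
have IJfin : (\int[P]_x (I x * J x)%:E)%E \is a fin_num by exact: integrable_fin_num.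
have cosfin : (\int[mu]_(w in pos) (cos ((t - s) * w) * Q w)%:E)%E \is a fin_num by exact: integrable_fin_num.
have cE' : (c%:E = a%:E + b%:E + 2%:E * \int[P]_x (I x * J x)%:E)%E.
  rewrite -cE -aE -bE.
  have sqr_int f : f \in Lfun P 2%:E -> P.-integrable setT (fun x => (f x ^+ 2)%:E).
    by move=> fL; under [X in integrable _ _ X]funext do rewrite expr2; exact: Lfun2_integrableM.
  have i1 := sqr_int _ I2'; have i2 := sqr_int _ J2'.
  have i12 : P.-integrable setT (fun x => (I x ^+ 2)%:E + (J x ^+ 2)%:E)%E by exact: integrableD.
  have i3 : P.-integrable setT (fun x => 2%:E * (I x * J x)%:E)%E by exact: integrableZl.
  rewrite -(integralZl measurableT iIJ) -(integralD measurableT i1 i2).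
  rewrite -(integralD measurableT i12 i3).
  by apply: eq_integral => x _; rewrite -EFinM -!EFinD -[X in (X ^+ 2)%:E]/(I x + J x); congr (_%:E); ring.
have icE' : ((2 * k * c)%:E = 2%:E * (2 * k * a)%:E +
    2%:E * \int[mu]_(w in pos) (cos ((t - s) * w) * Q w)%:E)%E.
  have i1 : mu.-integrable pos (fun w => 2%:E * (Q w)%:E)%E by exact: integrableZl.
  have i2 : mu.-integrable pos (fun w => 2%:E * (cos ((t - s) * w) * Q w)%:E)%E.
    exact: integrableZl.
  rewrite -icE -QE.
  rewrite -[X in (X + _)%E](_ : (\int[mu]_(w in pos) (2%:E * (Q w)%:E) = _)%E); last exact: integralZl.
  rewrite -[X in (_ + X)%E](_ : (\int[mu]_(w in pos) (2%:E * (cos ((t - s) * w) * Q w)%:E) = _)%E); last first.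
    exact: integralZl.
  rewrite -integralD//.
  by apply: eq_integral => w _; rewrite sumE.
rewrite -(fineK IJfin) -(fineK cosfin) -EFinM; congr (_%:E).
move: cE' icE'; rewrite -{1}(fineK IJfin) -(fineK cosfin) -!EFinM -!EFinD.
(* Both second moments come from the integral of [Q]; with them equal, the two expressions for c
   leave only the cross terms. *)
have ab : 2 * k * a = 2 * k * b by apply: EFin_inj; rewrite -QE -QE'.
move=> [cE'] [icE']; rewrite cE' in icE'.
by move: icE' ab; lra.
Qed.

End fbm_limits.

(** * Moments of the stationary process *)

Section affine_moments.
Context d (T : measurableType d) (R : realType) (P : probability T R).
Variables (m s : R).

Lemma ae_eq_affine (U I : {RV P >-> R}) (F : R -> R) : measurable_fun setT F ->
  {ae P, forall x, U x = m + s * I x} ->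
  (\int[P]_x (F (U x))%:E = \int[P]_x (F (m + s * I x))%:E)%E.
Proof.
move=> mF UI; apply: ae_eq_integral => //.
- by apply/measurable_EFinP; apply: measurableT_comp.
- apply/measurable_EFinP; apply: measurableT_comp => //.
  by apply: measurable_funD => //; apply: measurable_funM.
- by apply: filterS UI => x /= ->.
Qed.

Lemma affine_Lfun2 (U I : {RV P >-> R}) : (I : T -> R) \in Lfun P 2%:E ->
  {ae P, forall x, U x = m + s * I x} -> (U : T -> R) \in Lfun P 2%:E.
Proof.
move=> I2 UI.
have i0 : P.-integrable setT (EFin \o cst (m ^+ 2)) by exact: finite_measure_integrable_cst.
have i1 := integrableZl measurableT (2 * m * s) (Lfun2_integrable I2).
have i2 := integrableZl measurableT (s ^+ 2) (Lfun2_integrableM I2 I2).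
have i3 := integrableD measurableT (integrableD measurableT i0 i1) i2.
have E : (\int[P]_x ((U x) ^+ 2)%:E)%E = (\int[P]_x
    (((EFin \o cst (m ^+ 2)%R) x + (2 * m * s)%:E * (EFin \o I) x) +
     (s ^+ 2)%:E * (I x * I x)%:E))%E.
  rewrite (@ae_eq_affine _ I (fun x : R => x ^+ 2))//.
  by apply: eq_integral => x _; rewrite /= -!EFinM -!EFinD; congr (_%:E); ring.
apply: (@Lfun2_sqr _ _ _ _ _ (fine (\int[P]_x ((U x) ^+ 2)%:E)%E)) => //.
by rewrite fineK// E; exact: integrable_fin_num.
Qed.

Lemma affine_expectation (U I : {RV P >-> R}) : (I : T -> R) \in Lfun P 2%:E ->
  (\int[P]_x (I x)%:E = 0)%E ->
  {ae P, forall x, U x = m + s * I x} -> ('E_P[U] = m%:E)%E.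
Proof.
move=> I2 I0 UI; rewrite unlock.
rewrite (@ae_eq_affine _ I id)//.
have i0 : P.-integrable setT (EFin \o cst m) by exact: finite_measure_integrable_cst.
have i1 := integrableZl measurableT s (Lfun2_integrable I2).
transitivity (\int[P]_x ((EFin \o cst m) x + s%:E * (EFin \o I) x))%E.
  by apply: eq_integral.
rewrite (integralD measurableT i0 i1) (integralZl measurableT (Lfun2_integrable I2)) /=.
rewrite I0 mule0 adde0.
by have := expectation_cst P m; rewrite unlock.
Qed.

Lemma affine_covariance (U V I J : {RV P >-> R}) :
  ('E_P[U] = m%:E)%E -> ('E_P[V] = m%:E)%E ->
  (I : T -> R) \in Lfun P 2%:E -> (J : T -> R) \in Lfun P 2%:E ->
  {ae P, forall x, U x = m + s * I x} -> {ae P, forall x, V x = m + s * J x} ->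
  (covariance P U V = (s ^+ 2)%:E * \int[P]_x (I x * J x)%:E)%E.
Proof.
move=> EU EV I2 J2 UI VJ; rewrite covariance.unlock EU EV expectation.unlock /=.
rewrite -(integralZl measurableT (Lfun2_integrableM I2 J2)).
apply: ae_eq_integral => //.
- apply/measurable_EFinP; apply: measurable_funM; apply: measurable_funB => //.
- by apply: emeasurable_funM => //; apply/measurable_EFinP; apply: measurable_funM.
- apply: filterS2 UI VJ => x /= UE VE _.
  rewrite -EFinM; congr (_%:E).
  rewrite -[LHS]/((U x - m) * (V x - m)) UE VE; ring.
Qed.

End affine_moments.

Section stationary_limits.
Context d (T : measurableType d) (R : realType) (P : probability T R).
Variables (H : R) (B : R -> {RV P >-> R}).
Hypotheses (H01 : 0 < H < 1) (hB : is_fBm H B).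
Local Notation mu := (@lebesgue_measure R).
Local Notation pos := (`]0%R, +oo[%classic : set R).
Variables (k : R).
Hypotheses (k0 : 0 < k) (kE : (\int[mu]_(w in pos) (cos_defect H 1 w)%:E)%E = k%:E).

Lemma step_limit_Lfun2 l e (I : {RV P >-> R}) f : step_limit B l e I f ->
  (I : T -> R) \in Lfun P 2%:E.
Proof.
move=> [e0 c le_e lf].
have [a aE _] := step_isometry_cvg H01 hB k0 kE e0 c le_e lf.
exact: Lfun2_sqr aE.
Qed.

Lemma step_limit_mean l e (I : {RV P >-> R}) f : step_limit B l e I f ->
  (\int[P]_x (I x)%:E = 0)%E.
Proof.
move=> If; have I2 := step_limit_Lfun2 If; have [e0 c le_e lf] := If.
apply: (@mean_zero_L2_limit _ _ _ P (fun n => step_rv B (l n)) I e _ I2 _ le_e c) => n.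
- exact: (step_rv_Lfun2 hB).
- exact: (expectation_step hB).
Qed.

Variables (m s : R) (g : R -> R[i]) (Y I : R -> {RV P >-> R}).
Variables (l : R -> nat -> seq (R * R)) (e : R -> R^nat).
Hypotheses (YI : forall t, {ae P, forall x, Y t x = m + s * I t x})
  (Il : forall t, step_limit B (l t) (e t) (I t) (fun w => expi (t * w) * g w)).

(** Only t - u enters the right-hand side, which gives weak stationarity. The factor 2k is that of
    the isometry, and s^2 comes from the scale of Y. *)
Lemma stationary_limit_covariance t u :
  (covariance P (Y t) (Y u) = (s ^+ 2 / (2 * k))%:E *
     \int[mu]_(w in pos) (cos ((t - u) * w) * (sqnormC (g w) * fbm_weight H w))%:E)%E.
Proof.
have L2 v := step_limit_Lfun2 (Il v).
have EY v : ('E_P[Y v] = m%:E)%E.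
  exact: affine_expectation (L2 v) (step_limit_mean (Il v)) (YI v).
rewrite (affine_covariance (EY t) (EY u) (L2 t) (L2 u) (YI t) (YI u)).
have [_ <-] := step_limit_cov H01 hB k0 kE (Il t) (Il u).
rewrite muleA -EFinM; congr (_%:E * _)%E.
by rewrite divfK// gt_eqF// mulr_gt0.
Qed.

Lemma stationary_limit : weakly_stationary Y.
Proof.
have L2 v := step_limit_Lfun2 (Il v).
split.
- by move=> t; exact: affine_Lfun2 (L2 t) (YI t).
- by exists m => t; exact: affine_expectation (L2 t) (step_limit_mean (Il t)) (YI t).
- by move=> t h; rewrite !stationary_limit_covariance addrAC subrr add0r subr0.
Qed.

Lemma stationary_limit_autocovariance h : (autocovariance Y h)%:E = ((s ^+ 2 / (2 * k))%:E *
     \int[mu]_(w in pos) (cos (h * w) * (sqnormC (g w) * fbm_weight H w))%:E)%E.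
Proof.
rewrite /autocovariance stationary_limit_covariance subr0 fineK//.
have [] := step_limit_cov H01 hB k0 kE (Il h) (Il 0); rewrite subr0 => int _.
by rewrite fin_numM//; apply: integrable_fin_num int; exact: measurable_itv.
Qed.

Lemma stationary_limit_integrable h :
  mu.-integrable pos (fun w => (cos (h * w) * (sqnormC (g w) * fbm_weight H w))%:E).
Proof. by have [] := step_limit_cov H01 hB k0 kE (Il h) (Il 0); rewrite subr0. Qed.

End stationary_limits.

(** * The transfer function of the CARFIMA kernel *)

Section carfima_transfer.
Context d (T : measurableType d) (R : realType) (P : probability T R).
Variables (p' q : nat) (alpha beta : nat -> R).
Local Notation p := p'.+1.
Hypothesis qp : (q < p)%N.

(** The factor iw comes from the increments of e^{itw}, the quotient from the resolvent of the
    companion matrix. *)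
Definition carfima_transfer (w : R) : R[i] :=
  (0 +i* w)%C * (ceval (beta_poly q beta) (0 +i* w)%C / ceval (alpha_poly p alpha) (0 +i* w)%C).

Lemma carfima_kernelE : carfima_kernel p q alpha beta =
  matrix_kernel (companion p alpha) (beta_vec p q beta)^T (delta_vec R p).
Proof. by apply/funext => s; rewrite /carfima_kernel /matrix_kernel expmxE. Qed.

Lemma carfima_step_limit (B : R -> {RV P >-> R}) (t : R) (I : {RV P >-> R}) :
  stable p alpha ->
  is_ms_integral_ninfty B (fun u => carfima_kernel p q alpha beta (t - u)) t I ->
  exists l, step_limit B l (fun n => 4 * n.+1%:R^-1) I
    (fun w => expi (t * w) * carfima_transfer w).
Proof.
move=> stab /ms_integral_approx[h [m hm]].
have hpos n : 0 < h n by have [/andP[]] := hm n.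
exists (fun n => riemann_step (fun u => carfima_kernel p q alpha beta (t - u)) t (h n) (m n)).
split.
- by move=> n; rewrite mulr_ge0.
- by rewrite -(mulr0 4); apply: cvgMr; exact: cvg_harmonic.
- by move=> n; have [] := hm n.
- move=> w w0; under [X in cvgC X]funext do rewrite step_fourier_riemann.
  apply: cvgCM; first exact: cvgC_cst.
  rewrite /carfima_transfer -(beta_resolvent alpha beta qp) carfima_kernelE.
  apply: cvgC_riemann_transform => //.
  + by move=> n; rewrite gt_eqF.
  + apply: (@squeeze_cvgr _ _ _ _ (cst 0) (@harmonic R)).
    * by apply: nearW => n; have [/andP[/ltW -> ->]] := hm n.
    * exact: cvg_cst.
    * exact: cvg_harmonic.
  + apply: ger_cvgy cvgr_idn; apply: nearW => n; have [_ + _] := hm n.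
    by apply: le_trans; rewrite ler_nat.
  (* Stability excludes iw as an eigenvalue, so alpha(iw) is nonzero. *)
  + by apply: companion_resolvent; apply: alpha_neq0; apply: det_iw_neq0.
Qed.

End carfima_transfer.

(** * The stated density *)

Section carfima_density.
Variable R : realType.

Lemma cabs_sqr (z : R[i]) : cabs z ^+ 2 = sqnormC z.
Proof.
case: z => a b; rewrite /cabs /sqnormC /= sqr_sqrtr//.
by rewrite addr_ge0 ?sqr_ge0.
Qed.

Lemma sqnormCV (z : R[i]) : sqnormC z^-1 = (sqnormC z)^-1.
Proof.
have [->|z0] := eqVneq z 0; first by rewrite invr0 /sqnormC/= expr0n addr0 invr0.
have n0 : sqnormC z != 0 by rewrite sqnormC_eq0.
apply: (mulfI n0); rewrite -sqnormCM !divff//.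
by rewrite /sqnormC/= expr1n expr0n addr0.
Qed.

(** Real coefficients commute with conjugation. At iw, whose conjugate is -iw, this makes the
    density even. *)
Lemma ceval_conj (a : {poly R}) (z : R[i]) :
  ceval a (complex.Re z -i* complex.Im z)%C =
  (complex.Re (ceval a z) -i* complex.Im (ceval a z))%C.
Proof.
elim/poly_ind: a => [|a c IH]; first by rewrite /ceval rmorph0 !horner0 /= oppr0.
rewrite /ceval !rmorphD !rmorphM/= !map_polyX !map_polyC/= !hornerMXaddC.
rewrite -!/(ceval _ _) IH; case: (ceval a z) => x y; case: z {IH} => u v.
by apply/eqP; rewrite eq_complex/= ; apply/andP; split; apply/eqP; ring.
Qed.

Lemma sqnormC_ceval_even (a : {poly R}) (w : R) :
  sqnormC (ceval a (0 +i* - w)%C) = sqnormC (ceval a (0 +i* w)%C).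
Proof.
by rewrite (ceval_conj a (0 +i* w)%C) /sqnormC/= sqrrN.
Qed.

Variables (p q : nat) (alpha beta : nat -> R) (H sigma : R).
Hypothesis H01 : 0 < H < 1.
Local Notation f := (carfima_spectral_density p q alpha beta H sigma).

Lemma carfima_density_even w : f (- w) = f w.
Proof.
by rewrite /carfima_spectral_density normrN !cabs_sqr !sqnormC_ceval_even.
Qed.

Lemma carfima_density_ge0 w : 0 <= f w.
Proof.
case/andP: H01 => H0 H1.
rewrite /carfima_spectral_density !cabs_sqr.
apply: mulr_ge0; last by rewrite divr_ge0 ?sqnormC_ge0.
apply: mulr_ge0; last exact: powR_ge0.
apply: mulr_ge0.
  rewrite mulr_ge0//; first by rewrite divr_ge0 ?sqr_ge0// mulr_ge0// pi_ge0.
  by apply: Rintegral_ge0 => x _; rewrite mulr_ge0 ?powR_ge0 ?expR_ge0.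
rewrite sin_ge0_pi// mulr_ge0 ?pi_ge0 ?(ltW H0)//=.
by rewrite ler_piMr ?pi_ge0// ltW.
Qed.

(** |w|^(1-2H) = |iw|^2 w^(-1-2H) moves a factor iw into the transfer function, and Gamma(2H+1)
    sin(pi H) = pi / (2k) turns sigma^2 / (2 pi) into sigma^2 / (4k). *)
Lemma carfima_densityE (k w : R) : 0 < k -> k * Gamma (2 * H + 1) * sin (pi * H) = pi / 2 ->
  0 < w -> f w = sigma ^+ 2 / (4 * k) *
    (sqnormC ((0 +i* w)%C * (ceval (beta_poly q beta) (0 +i* w)%C /
       ceval (alpha_poly p alpha) (0 +i* w)%C)) * fbm_weight H w).
Proof.
move=> k0 kG w0; rewrite /carfima_spectral_density !cabs_sqr !sqnormCM.
have -> : sqnormC ((ceval (alpha_poly p alpha) (0 +i* w)%C)^-1) =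
    (sqnormC (ceval (alpha_poly p alpha) (0 +i* w)%C))^-1.
  exact: sqnormCV.
have -> : `|w| `^ (1 - 2 * H) = w ^+ 2 * fbm_weight H w.
  rewrite gtr0_norm// /fbm_weight -powR_mulrn ?ltW// -powRD; last by rewrite (gt_eqF w0) implybT.
  by congr (_ `^ _); ring.
have -> : sqnormC (0 +i* w)%C = w ^+ 2 by rewrite /sqnormC/= expr0n add0r.
have -> : sigma ^+ 2 / (2 * pi) * Gamma (2 * H + 1) * sin (pi * H) = sigma ^+ 2 / (4 * k).
  have scaling (x G s : R) : x != 0 -> k * G * s = x / 2 ->
      sigma ^+ 2 / (2 * x) * G * s = sigma ^+ 2 / (4 * k).
    move=> x0 kGs; have kn0 : k != 0 by rewrite gt_eqF.
    have -> : sigma ^+ 2 / (2 * x) * G * s = sigma ^+ 2 / (2 * x) / k * (k * G * s).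
      by field; rewrite x0 kn0.
    by rewrite kGs; field; rewrite x0 kn0.
  by apply: scaling kG; rewrite gt_eqF// pi_gt0.
ring.
Qed.

End carfima_density.

(** * Fourier integrals of even functions *)

Section even_density.
Variable R : realType.
Local Notation mu := (@lebesgue_measure R).
Local Notation pos := (`]0%R, +oo[%classic : set R).

(** The sine part is odd and cancels between the half-lines; the cosine part doubles. *)
Lemma Cintegral_expi_even (f : R -> R) (h : R) : (forall w, f (- w) = f w) ->
  mu.-integrable pos (fun w => (f w)%:E) ->
  mu.-integrable setT (fun w => (f w)%:E) /\
  Cintegral (fun w => expi (h * w) * (f w)%:C%C) =
    (2 * \int[mu]_(w in pos) (cos (h * w) * f w))%:C%C.
Proof.
move=> fE fi.
have mpos : measurable (pos : set (measurableTypeR R)) by exact: measurable_itv.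
have mf : measurable_fun pos f by apply/measurable_EFinP; exact: measurable_int fi.
have bounded (g : R -> R) : measurable_fun setT g -> (forall w, `|g w| <= 1) ->
    mu.-integrable pos (fun w => (g w * f w)%:E).
  move=> mg g1; apply: (@le_integrable _ _ _ mu pos mpos _ (fun w => (f w)%:E)) => //.
    by apply/measurable_EFinP; apply: measurable_funM => //; exact: measurable_funTS.
  by move=> w _; rewrite !abse_EFin lee_fin normrM ler_piMl.
have msin : measurable_fun [set: R] (fun w : R => sin (h * w)).
  by apply: (measurableT_comp (f := @sin R)) => //; apply: continuous_measurable_fun; exact: continuous_sin.
have mcos : measurable_fun [set: R] (fun w : R => cos (h * w)) by exact: measurable_cos_scale.
have icos := bounded _ mcos (fun w => cos_max (h * w)).
have isin := bounded _ msin (fun w => sin_max (h * w)).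
have cosN w : cos (h * - w) * f (- w) = cos (h * w) * f w by rewrite mulrN cosN fE.
have sinN w : sin (h * - w) * f (- w) = - (sin (h * w) * f w) by rewrite mulrN sinN fE mulNr.
split.
  have [] // := @integral_symmetrize _ f fi _.
  by under [X in integrable _ _ X]funext do rewrite fE.
have [|_ cosE] := @integral_symmetrize _ _ icos.
  by under [X in integrable _ _ X]funext do rewrite cosN.
have [|_ sinE] := @integral_symmetrize _ _ isin.
  under [X in integrable _ _ X]funext do rewrite sinN EFinN.
  exact: integrableN.
have cfin := integrable_fin_num mpos icos.
have sfin := integrable_fin_num mpos isin.
apply/eqP; rewrite eq_complex /=; apply/andP; split; apply/eqP.
  under eq_Rintegral do rewrite mulr0 subr0.
  rewrite /Rintegral cosE; under [X in (_ + X)%E]eq_integral do rewrite cosN.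
  by rewrite fineD// mulr_natl mulr2n.
under eq_Rintegral do rewrite mulr0 add0r.
rewrite /Rintegral sinE; under [X in (_ + X)%E]eq_integral do rewrite sinN EFinN.
rewrite integralN ?integrable_add_def// fineD ?fin_numN//.
by rewrite fineN subrr.
Qed.

End even_density.

Theorem theorem3 (R : realType) (d : measure_display) (T : measurableType d)
    (P : probability T R) (p q : nat) (alpha beta : nat -> R) (H sigma : R)
    (B Y : R -> {RV P >-> R})
    (hp : (1 <= p)%N) (hq : (q < p)%N)
    (halpha1 : alpha 1%N != 0)
    (hbetaq : (1 <= q)%N -> beta q != 0)
    (hsigma : 0 < sigma)
    (hH0 : 0 < H) (hH1 : H < 1)
    (hB : is_fBm H B)
    (hY : is_stationary_carfima p q alpha beta sigma B Y) :
  is_spectral_density Y (carfima_spectral_density p q alpha beta H sigma).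
Proof.
have H01 : 0 < H < 1 by rewrite hH0.
case: p hp hq hY => // p' _ qp [stab carY].
have [k k0 [kE kG]] := fbm_constant H01.
have /choice[I IY] : forall t, exists I : {RV P >-> R},
    is_ms_integral_ninfty B (fun u => carfima_kernel p'.+1 q alpha beta (t - u)) t I /\
    {ae P, forall w, Y t w = - (alpha 0%N / alpha 1%N) + sigma * I w}.
  by move=> t; have [I] := carY t; exists I.
have /choice[l Il] t := carfima_step_limit qp stab (IY t).1.
have YI t := (IY t).2.
pose Q w := sqnormC (carfima_transfer p' q alpha beta w) * fbm_weight H w.
pose f := carfima_spectral_density p'.+1 q alpha beta H sigma.
have fE w : 0 < w -> f w = sigma ^+ 2 / (4 * k) * Q w.
  exact: carfima_densityE.
have mpos : measurable (`]0%R, +oo[%classic : set (measurableTypeR R)) by exact: measurable_itv.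
(* At lag 0 the cosine is 1, which gives integrability of [Q] itself. *)
have iQ := stationary_limit_integrable H01 hB k0 kE Il 0.
have fi : lebesgue_measure.-integrable `]0, +oo[ (fun w => (f w)%:E).
  apply: eq_integrable (integrableZl mpos (sigma ^+ 2 / (4 * k)) iQ) => // w.
  by rewrite inE/= in_itv/= andbT => w0; rewrite mul0r cos0 mul1r fE.
have feven w : f (- w) = f w by exact: carfima_density_even.
split.
- exact: (stationary_limit H01 hB k0 kE YI Il).
- by move=> w; exact: carfima_density_ge0.
- by have [] := Cintegral_expi_even 0 feven fi.
- move=> h; have [_ ->] := Cintegral_expi_even h feven fi.
  congr (_%:C%C).
  have := stationary_limit_autocovariance H01 hB k0 kE YI Il h.
  have ih := stationary_limit_integrable H01 hB k0 kE Il h.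
  have fin := integrable_fin_num mpos ih.
  rewrite -(fineK fin) -EFinM => -[->].
  rewrite /Rintegral.
  under [in RHS]eq_integral => w.
    rewrite inE/= in_itv/= andbT => w0.
    rewrite fE// mulrCA EFinM.
    over.
  rewrite (integralZl mpos ih) fineM//= mulrA; congr (_ * _).
  (* 2 sigma^2 / (4k) = sigma^2 / (2k): a density on the whole line carries half of the half-line
     constant. *)
  by field; rewrite gt_eqF.
Qed.
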